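(* There exists an absolute constant $\epsilon_0>0$ such that the following holds. Let $\epsilon_1,\epsilon_2,C_1,C_2>0$ be real numbers with $\epsilon_1+\epsilon_2\le\epsilon_0$. Then there is $c_0>0$, depending only on $\epsilon_1$ and $\epsilon_2$, such that for every $c\in(0,c_0]$, for all integers $s,d$ with $2\sqrt d\le s\le d$, and for every $F:\mathbb R\to\mathbb R$ satisfying $$\text{(A1)}\quad \sup_{\sqrt{2\log(s^2/d)}\le M\le \sqrt{2\log(d)}} \frac{\|F-F(0)\|_{\infty,[-M,M]}}{e^{\epsilon_1M^2}} \le C_1,\qquad \text{(A2)}\quad \sup_{\sqrt{2\log(s^2/d)}\le M\le \sqrt{2\log(d)}} \frac{\delta^{-1}_{M^2,M}}{e^{\epsilon_2M^2}} \le C_2,$$ the estimator $\hat{\mathbf F}$ of $\mathbf F(\theta)=\sum_{i=1}^dF(\theta_i)$ defined in the context (with parameter $c$) satisfies $$\sup_{\theta\in\Theta_{s,\sqrt{2\log(d)}}}\mathbf E_\theta\big(\hat{\mathbf F}-\mathbf F(\theta)\big)^2\le C_3\,s^2\max_{l=0,\ldots,L+1}\delta^2_{K_l,M_l},$$ where $C_3>0$ is a constant depending only on $C_1$ and $C_2$.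
   Context: Parameter set: $\Theta_{s,M}=\{\theta\in\mathbb R^d : \|\theta\|_0\le s,\ \|\theta\|_\infty\le M\}$, where $\|\theta\|_0$ is the number of nonzero coordinates of $\theta$. Polynomial approximation: for real $K\ge0$, $\mathcal P_K$ is the set of real polynomials of degree at most $K$; $\|g\|_{\infty,[-M,M]}=\sup_{|x|\le M}|g(x)|$; $P_{K,M}\in\arg\min_{P\in\mathcal P_K}\|F-P\|_{\infty,[-M,M]}$ is a polynomial of best approximation of $F$ on $[-M,M]$, written $P_{K,M}=\sum_{k=0}^K a_{k,K,M}X^k$ (sums up to a real number $K$ run over integers $k\le K$); $\delta_{K,M}=\|F-P_{K,M}\|_{\infty,[-M,M]}$. Hermite polynomials: $H_k(x)=(-1)^ke^{x^2/2}\frac{d^k}{dx^k}\big(e^{-x^2/2}\big)$. Observations: the available data are random variables $y_{1,i},y_{2,i}$, $i=1,\dots,d$, all mutually independent, with $y_{1,i},y_{2,i}\sim\mathcal N(\theta_i,1)$. (They arise by splitting a Gaussian observation $y\sim\mathcal N(\theta,I_d)$ into two independent copies; the resulting variance $2$ is normalized to $1$ by convention.) $\mathbf E_\theta$ is the expectation under this model. Parameters (for a constant $c>0$): $M_l=2^l\sqrt{2\log(s^2/d)}$ for $0\le l\le L$, where $L$ is the largest integer such that $2^L<\sqrt{\log(d)/\log(s^2/d)}$; $M_{L+1}=\sqrt{2\log(d)}$; $K_l=\frac c8M_l^2$ for $0\le l\le L+1$; $t_l=M_l/2$ for $0\le l\le L$, and $t_{-1}=0$. Estimator: with $\hat P_{K,M}(u)=\sum_{k=1}^Ka_{k,K,M}H_k(u)$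 (the sum starts at $k=1$) and $$\hat F(u,v)=\sum_{l=0}^L\hat P_{K_l,M_l}(u)\,\mathbf 1_{t_{l-1}<|v|\le t_l}+\hat P_{K_{L+1},M_{L+1}}(u)\,\mathbf 1_{t_L<|v|},$$ set $\hat{\mathbf F}=dF(0)+\sum_{i=1}^d\hat F(y_{1,i},y_{2,i})$. *)

(* Defs.v *)
From HB Require Import structures.
From mathcomp Require Import all_boot all_order all_algebra.
From mathcomp Require Import all_classical all_reals all_analysis.

Set Implicit Arguments.
Unset Strict Implicit.
Unset Printing Implicit Defensive.

Import Order.TTheory GRing.Theory Num.Theory.
Import numFieldNormedType.Exports.

Local Open Scope classical_set_scope.
Local Open Scope ring_scope.

Section approximation.
Context {R : realType}.
Implicit Types (F g : R -> R) (K M : R) (p : {poly R}).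

(* Extended-real valued, so that no boundedness of g has to be presupposed. *)
Definition sup_norm g M : \bar R :=
  ereal_sup [set (`|g x|)%:E | x in [set x : R | `|x| <= M]].

(* Meant for K >= 0; the zero polynomial is included since size 0 = 0. *)
Definition deg_le p K : Prop := (size p).-1%:R <= K.

Definition best_approx F K M p : Prop :=
  deg_le p K /\
  forall q, deg_le q K ->
    (sup_norm (fun x => F x - p.[x])%R M <=
     sup_norm (fun x => F x - q.[x])%R M)%E.

(* P K M is the chosen polynomial of best approximation; it need not be unique,
   because F is not assumed continuous. *)
Definition best_approx_family F (P : R -> R -> {poly R}) : Prop :=
  forall K M, 0 <= K -> 0 <= M -> best_approx F K M (P K M).

Definition delta F (P : R -> R -> {poly R}) K M : \bar R :=
  sup_norm (fun x => F x - (P K M).[x]) M.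

(* Probabilists' normalization. *)
Definition hermite (k : nat) (x : R) : R :=
  (-1) ^+ k * expR (x ^+ 2 / 2) *
  derive1n k (fun z : R => expR (- (z ^+ 2 / 2))) x.

Definition Phat (P : R -> R -> {poly R}) K M (u : R) : R :=
  \sum_(1 <= k < (Num.truncn K).+1) (P K M)`_k * hermite k u.

End approximation.

Section levels.
Context {R : realType}.
Variables (s d : nat).

Definition Mmin : R := Num.sqrt (2 * ln (s%:R ^+ 2 / d%:R)).
Definition Mmax : R := Num.sqrt (2 * ln d%:R).

(* L can be -1, namely when s = d. *)
Definition largest_level (L : int) : Prop :=
  let admissible (k : int) :=
    (2 : R) ^ k < Num.sqrt (ln d%:R / ln (s%:R ^+ 2 / d%:R)) in
  admissible L /\ forall k : int, admissible k -> k <= L.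

Variables (L : int) (c : R).

Definition Mlev (l : int) : R := if l <= L then 2 ^ l * Mmin else Mmax.

Definition Klev (l : int) : R := c / 8 * Mlev l ^+ 2.

Definition tlev (l : int) : R := if l < 0 then 0 else Mlev l / 2.

(* L + 1 as a natural number (L >= -1), so that l < nlev means l <= L. *)
Definition nlev : nat := absz (L + 1).

Definition Fhat (P : R -> R -> {poly R}) (u v : R) : R :=
  \sum_(0 <= l < nlev)
     Phat P (Klev l%:Z) (Mlev l%:Z) u *
     (tlev (l%:Z - 1) < `|v| <= tlev l%:Z)%R%:R
  + Phat P (Klev (L + 1)) (Mlev (L + 1)) u * (tlev L < `|v|)%R%:R.

Definition estimator (F : R -> R) (P : R -> R -> {poly R})
    (y1 y2 : 'I_d -> R) : R :=
  d%:R * F 0 + \sum_(i < d) Fhat P (y1 i) (y2 i).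

Definition max_delta2 (F : R -> R) (P : R -> R -> {poly R}) : \bar R :=
  \big[maxe/0%E]_(0 <= l < nlev.+1)
    ((delta F P (Klev l%:Z) (Mlev l%:Z)) ^+ 2)%E.

End levels.

Section growth_conditions.
Context {R : realType}.
Variables (s d : nat) (F : R -> R).

Definition A1 (eps1 C1 : R) : Prop :=
  (ereal_sup [set sup_norm (fun x => F x - F 0)%R M / (expR (eps1 * M ^+ 2))%:E
             | M in [set M : R | (Mmin s d <= M <= Mmax d)%R]] <= C1%:E)%E.

(* The extended-real inverse has 0^-1 = +oo, so delta > 0 is part of this. *)
Definition A2 (P : R -> R -> {poly R}) (eps2 C2 : R) : Prop :=
  (ereal_sup [set (delta F P (M ^+ 2)%R M)^-1 / (expR (eps2 * M ^+ 2))%:E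
             | M in [set M : R | (Mmin s d <= M <= Mmax d)%R]] <= C2%:E)%E.

End growth_conditions.

Section model.
Context {R : realType}.

Definition Theta (d s : nat) (M : R) : set 'rV[R]_d :=
  [set theta : 'rV[R]_d |
    (#|[set i : 'I_d | theta ord0 i != 0%R]%SET| <= s)%N /\ `|theta| <= M].

Definition mutually_independent (disp : measure_display)
    (T : measurableType disp) (P : probability T R) (I : finType)
    (X : I -> T -> R) : Prop :=
  forall (J : {set I}) (A : I -> set R), (forall i, measurable (A i)) ->
    P (\bigcap_(i in [set i | i \in J]) (X i @^-1` A i)) =
    (\prod_(i in J) P (X i @^-1` A i))%E.

(* The second parameter of normal_prob is the standard deviation. *)
Definition gaussian_sample (disp : measure_display) (T : measurableType disp)
    (d : nat) (P : probability T R) (theta : 'rV[R]_d)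
    (y1 y2 : 'I_d -> {mfun T >-> R}) : Prop :=
  [/\ mutually_independent P
        (fun k : 'I_d + 'I_d =>
           match k with inl i => y1 i : T -> R | inr i => y2 i : T -> R end),
      forall i (A : set R), measurable A ->
        distribution P (y1 i) A = normal_prob (theta ord0 i) 1 A
    & forall i (A : set R), measurable A ->
        distribution P (y2 i) A = normal_prob (theta ord0 i) 1 A].

Definition Fsum (d : nat) (F : R -> R) (theta : 'rV[R]_d) : R :=
  \sum_(i < d) F (theta ord0 i).

End model.

(* Main.v *)
(**
  Bias-variance decomposition, coordinate by coordinate.  Since
  E H_k(u) = theta^k for u ~ N(theta, 1), the estimator of one coordinate has
  mean \sum_l p_l (P_l(theta) - P_l(0)), where p_l is the probability that the
  second copy v selects level l.  The bias is therefore 0 at theta = 0.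
  Elsewhere, the levels with |theta| <= M_l contribute at most 2 delta_l, and
  on the other ones p_l <= 2 exp(-theta^2/16) beats the growth of P_l; by (A2),
  1 <= C_2 delta_l exp(eps_2 M_l^2), so that these terms sum to a multiple of
  max delta_l.  As at most s coordinates are nonzero, the squared total bias is
  of order s^2 max delta_l^2.

  For the variance, |H_k(u)| <= (|u| + sqrt K)^k for k <= K and the bound
  sum_k |a_k| M^k <= A exp(3K) for polynomials of degree at most K that are
  bounded by A on [-M, M] give the pointwise bound
  hat P_l(u)^2 <= C exp(O(eps_1 + c) M_l^2 + c theta^2/2) exp((u - theta)^2/4).
  At a nonzero coordinate this is compensated by s >= exp(M_l^2/4), at a zero
  one by s^2/d = exp(M_0^2/2) on level 0 and by
  p_l <= 2 exp(-M_l^2/64) on the levels l >= 1.  All the tails are obtained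
  from the single moment E exp((u - theta)^2/4) = sqrt 2.
*)
From HB Require Import structures.
Require Import Defs.
From mathcomp Require Import all_boot all_order all_algebra.
From mathcomp Require Import all_classical all_reals all_analysis.
From mathcomp Require Import qpoly measurable_realfun zify ring lra.

Set Implicit Arguments.
Unset Strict Implicit.
Unset Printing Implicit Defensive.

Import Order.TTheory GRing.Theory Num.Theory.
Import numFieldNormedType.Exports.

Local Open Scope classical_set_scope.
Local Open Scope ring_scope.

Lemma expr_le_fact_expR (R : realType) k (y : R) : 0 <= y -> y ^+ k <= k`!%:R * expR y.
Proof.
move=> y0; case: k => [|k]; first by rewrite expr0 mul1r -[leLHS]expR0 ler_expR.
rewrite mulrC -ler_pdivrMr ?ltr0n ?fact_gt0//.
by apply: le_trans (expR_ge1Dxn k y0); rewrite lerDr.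
Qed.

(** Serves to turn powers of a ratio into exponentials of its square, a form that a Gaussian moment
    can absorb. *)
Lemma le_expR_half_sqr (R : realType) (t : R) : t <= expR (t ^+ 2 / 2).
Proof.
apply: le_trans (expR_ge1Dx _).
have := sqr_ge0 (t - 1); nra.
Qed.

Lemma sqrtr2_le2 (R : realType) : Num.sqrt 2 <= 2 :> R.
Proof. by rewrite -[leRHS]ger0_norm// -sqrtr_sqr ler_wsqrtr//; lra. Qed.

(** * Hermite polynomials and Gaussian moments *)

Section hermite_polynomials.
Context {R : realType}.

(** Hermite polynomials through the raising operator [p |-> X p - p'], which is what differentiation
    against a Gaussian weight produces. *)
Fixpoint hpoly (k : nat) : {poly R} :=
  if k is k'.+1 then 'X * hpoly k' - (hpoly k')^`() else 1.

(** The Appell property; it replaces the derivative in the recursion by a lower Hermite polynomial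
    and so yields the three-term recurrence. *)
Lemma deriv_hpoly k : (hpoly k.+1)^`() = k.+1%:R *: hpoly k.
Proof.
elim: k => [|k IH].
  by rewrite /= mulr1 derivC subr0 derivX scale1r.
rewrite [hpoly k.+2]/= -/(hpoly k.+1) derivB derivM derivX mul1r IH.
rewrite derivZ -scalerAr -addrA -scalerBr.
by rewrite -[X in _ + _ *: X]/(hpoly k.+1) -[X in X + _]scale1r -scalerDl nat1r.
Qed.

Lemma hpolySS k : hpoly k.+2 = 'X * hpoly k.+1 - k.+1%:R *: hpoly k.
Proof. by rewrite -deriv_hpoly. Qed.

(* The three-term recurrence gives the induction step, since
   [|x| A + B ^ 2 <= A ^ 2] for [A = |x| + B]. *)
Lemma hpoly_ub k (x B : R) : 0 <= B -> k%:R <= B ^+ 2 ->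
  `|(hpoly k).[x]| <= (`|x| + B) ^+ k.
Proof.
move=> B0; have A0 : 0 <= `|x| + B by rewrite addr_ge0.
(* Two consecutive ranks are carried together, since the recurrence reaches back two steps. *)
suff H : (k%:R <= B ^+ 2 -> `|(hpoly k).[x]| <= (`|x| + B) ^+ k) /\
   (k.+1%:R <= B ^+ 2 -> `|(hpoly k.+1).[x]| <= (`|x| + B) ^+ k.+1).
  by case: H.
elim: k => [|k [IH1 IH2]].
  split=> _; first by rewrite hornerE normr1.
  by rewrite /= mulr1 derivC subr0 hornerX expr1 lerDl.
split=> // kB; have kB1 : k.+1%:R <= B ^+ 2.
  by apply: le_trans kB; rewrite ler_nat.
have kB0 : k%:R <= B ^+ 2 by apply: le_trans kB1; rewrite ler_nat.
rewrite hpolySS hornerD hornerN hornerM hornerX hornerZ.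
apply: (le_trans (ler_normB _ _)); rewrite !normrM normr_nat.
apply: (@le_trans _ _ (`|x| * (`|x| + B) ^+ k.+1 + B ^+ 2 * (`|x| + B) ^+ k)).
  apply: lerD; first by apply: ler_wpM2l => //; exact: IH2.
  by apply: ler_pM => //; exact: IH1.
rewrite -[k.+2]/(2 + k)%N exprD (exprS _ k) mulrA -mulrDl.
apply: ler_wpM2r; first exact: exprn_ge0.
have x0 := normr_ge0 x; nra.
Qed.

(** The product rule turns [hpoly k] times the Gaussian into minus its raised successor, hence the
    alternating sign. *)
Lemma derive1n_gauss k :
  derive1n k (fun z : R => expR (- (z ^+ 2 / 2))) =
  (fun x : R => (-1 : R) ^+ k * (hpoly k).[x] * expR (- (x ^+ 2 / 2)) : R).
Proof.
elim: k => [|k IH].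
  by apply/funext => x; rewrite derive1n0 expr0 mul1r hornerC mul1r.
rewrite derive1nS IH; apply/funext => x.
have dexp : is_derive x 1 (fun z : R => expR (- (z ^+ 2 / 2)))
    (- x * expR (- (x ^+ 2 / 2))).
  apply: is_derive_eq; rewrite /GRing.scale/=; by field.
have dp := is_derive_poly (hpoly k) x.
have -> : (fun z => (-1 : R) ^+ k * (hpoly k).[z] * expR (- (z ^+ 2 / 2))) =
    (fun z => (-1 : R) ^+ k * (horner (hpoly k) z * expR (- (z ^+ 2 / 2)))).
  by apply/funext => z; rewrite mulrA.
rewrite derive1E; apply: derive_val; apply: is_derive_eq.
rewrite /GRing.scale/= hornerD hornerN hornerM hornerX (exprS _ k) mulN1r.
have key (q b b' y e : R) : q * (b * (- y * e) + e * b') = - q * (y * b - b') * e.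
  by ring.
exact: key.
Qed.

Lemma hermiteE k (x : R) : hermite k x = (hpoly k).[x].
Proof.
rewrite /hermite derive1n_gauss.
rewrite (_ : _ * _ * (_ * _ * _) = ((-1) ^+ k * (-1) ^+ k) * (hpoly k).[x] *
   (expR (x ^+ 2 / 2) * expR (- (x ^+ 2 / 2)))); last by ring.
by rewrite expRxMexpNx_1 -expr2 sqrr_sign mul1r mulr1.
Qed.

End hermite_polynomials.

(** * Integration against a normal law through its density *)

Section normal_density.
Context {R : realType}.
Variables (m s : R).
Local Notation mu := (@lebesgue_measure R).

(** The change of variables produces the Radon-Nikodym derivative, which equals [normal_pdf] almost
    everywhere because both integrate to the same value on every measurable set. *)
Lemma ge0_integral_normal_prob (f : R -> \bar R) :
  measurable_fun [set: R] f -> (forall x, 0 <= f x)%E ->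
  (\int[normal_prob m s]_x f x = \int[mu]_x (f x * (normal_pdf m s x)%:E))%E.
Proof.
move=> mf f0; have dom := normal_prob_dominates m s.
rewrite -(Radon_Nikodym_SigmaFinite.change_of_variables dom)//.
have mg : measurable_fun setT (EFin \o normal_pdf m s).
  by apply/measurable_EFinP; exact: measurable_normal_pdf.
have ig := Radon_Nikodym_SigmaFinite.f_integrable dom.
apply: ae_eq_integral => //.
- by apply: emeasurable_funM => //; exact: measurable_int ig.
- exact: emeasurable_funM.
- apply: ae_eqe_mul2l; apply: integral_ae_eq => //.
  by move=> A _ mA; rewrite -(Radon_Nikodym_SigmaFinite.f_integral dom).
Qed.

Lemma integrable_normal_prob (f : R -> R) :
  measurable_fun [set: R] f ->
  mu.-integrable setT (EFin \o (fun x => f x * normal_pdf m s x)) ->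
  (normal_prob m s).-integrable setT (EFin \o f).
Proof.
move=> mf /integrableP[_ fi]; apply/integrableP; split; first exact/measurable_EFinP.
rewrite ge0_integral_normal_prob//; last first.
  by apply: measurableT_comp => //; exact/measurable_EFinP.
apply: le_lt_trans fi; rewrite le_eqVlt; apply/orP; left; apply/eqP.
apply: eq_integral => x _ /=; rewrite normrM EFinM.
by rewrite [in RHS](ger0_norm (normal_pdf_ge0 _ _ _)).
Qed.

Lemma integral_normal_prob (f : R -> R) :
  (normal_prob m s).-integrable setT (EFin \o f) ->
  (\int[normal_prob m s]_x (f x)%:E = \int[mu]_x (f x * normal_pdf m s x)%:E)%E.
Proof.
move=> fi; have /measurable_EFinP mf := measurable_int _ fi.
rewrite [LHS]integralE [RHS]integralE.
rewrite !ge0_integral_normal_prob//; last 2 first.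
  by apply: measurable_funeneg; exact/measurable_EFinP.
  by apply: measurable_funepos; exact/measurable_EFinP.
congr (_ - _)%E; apply: eq_integral => x _.
  rewrite !funeposE -!EFin_max -EFinM maxr_pMl ?mul0r//; exact: normal_pdf_ge0.
rewrite !funenegE/= -!EFin_max -EFinM maxr_pMl ?mul0r ?mulNr//.
exact: normal_pdf_ge0.
Qed.

End normal_density.

(** * The Gaussian exponential moment and integrability of Hermite polynomials *)

Section gaussian_moments.
Context {R : realType}.
Variable m : R.
Local Notation mu := (@lebesgue_measure R).

(** Tilting doubles the variance. The total mass [sqrt 2] of the right side is the single moment
    behind all later tail and second-moment bounds. *)
Lemma expR_sqr_normal_pdf x :
  expR ((x - m) ^+ 2 / 4) * normal_pdf m 1 x =
  Num.sqrt 2 * normal_pdf m (Num.sqrt 2) x.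
Proof.
have s20 : Num.sqrt 2 != 0 :> R by rewrite gt_eqF// sqrtr_gt0.
rewrite !normal_pdfE ?oner_eq0// /normal_peak /normal_fun expr1n sqr_sqrtr//.
have -> : Num.sqrt (2 * pi *+ 2) = Num.sqrt 2 * Num.sqrt (1 * pi *+ 2) :> R.
  rewrite -sqrtrM// mul1r. congr Num.sqrt; move: pi => p; ring.
have -> : expR (- (x - m) ^+ 2 / (2 *+ 2)) =
    expR ((x - m) ^+ 2 / 4) * expR (- (x - m) ^+ 2 / 2).
  by rewrite -expRD; congr expR; field.
rewrite invfM !mulrA divff// !mul1r; congr (_ * _); exact: mulrC.
Qed.

Lemma integrable_expR_sqr :
  (normal_prob m 1).-integrable setT (EFin \o (fun x => expR ((x - m) ^+ 2 / 4))).
Proof.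
apply: integrable_normal_prob.
  apply: measurableT_comp => //; apply: measurable_funM => //.
  by apply: measurable_funX; exact: measurable_funB.
rewrite [X in _.-integrable _ X](_ : _ = fun x =>
  ((Num.sqrt 2)%:E * (normal_pdf m (Num.sqrt 2) x)%:E)%E); last first.
  by apply/funext => x; rewrite /= expR_sqr_normal_pdf.
by apply: integrableZl => //; exact: integrable_normal_pdf.
Qed.

Lemma integral_expR_sqr :
  (\int[normal_prob m 1]_x (expR ((x - m) ^+ 2 / 4))%:E = (Num.sqrt 2)%:E)%E.
Proof.
rewrite (integral_normal_prob integrable_expR_sqr).
under eq_integral do rewrite expR_sqr_normal_pdf EFinM.
by rewrite integralZl ?integral_normal_pdf ?mule1//; exact: integrable_normal_pdf.
Qed.

(** Combines [hpoly_ub] for [B = k], the bound [y^k <= k! exp y], and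
    [|x - m| <= (x - m)^2 / 4 + 1]. *)
Lemma hpoly_expR_ub k : exists2 C, 0 <= C &
  forall x, `|(hpoly k).[x]| <= C * expR ((x - m) ^+ 2 / 4).
Proof.
exists (k`!%:R * expR (1 + `|m| + k%:R)) => [|x].
  by rewrite mulr_ge0// expR_ge0.
have kk : k%:R <= (k%:R : R) ^+ 2.
  by rewrite -natrX ler_nat; case: (k) => // n; rewrite expnS leq_pmulr// expn_gt0.
apply: le_trans (hpoly_ub x (ler0n _ k) kk) _.
apply: le_trans (expr_le_fact_expR k _) _; first by rewrite addr_ge0.
rewrite -mulrA ler_wpM2l// -expRD ler_expR.
have h1 : `|x| <= `|x - m| + `|m| by rewrite -{1}(subrK m x) ler_normD.
have h2 : (x - m) ^+ 2 = `|x - m| ^+ 2 by rewrite real_normK ?num_real.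
rewrite h2; set y := `|x - m| in h1 *.
have := sqr_ge0 (y / 2 - 1); nra.
Qed.

Lemma integrable_hpoly k :
  (normal_prob m 1).-integrable setT (EFin \o (fun x => (hpoly k).[x])).
Proof.
have [C C0 HC] := hpoly_expR_ub k.
have mh : measurable_fun [set: R] (horner (hpoly k) : R -> R).
  apply: continuous_measurable_fun; exact: continuous_horner.
apply: (@le_integrable _ _ _ (normal_prob m 1) _ measurableT _
   (fun x => C%:E * (expR ((x - m) ^+ 2 / 4))%:E)%E).
- exact/measurable_EFinP.
- move=> x _ /=; rewrite lee_fin (le_trans (HC x))//.
  by rewrite ger0_norm// mulr_ge0// expR_ge0.
- by apply: integrableZl => //; exact: integrable_expR_sqr.
Qed.

End gaussian_moments.

(** * Mean of a Hermite polynomial under a shifted normal law *)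

Section hermite_mean.
Context {R : realType}.
Variable m : R.
Local Notation mu := (@lebesgue_measure R).

(** Explicit decay at infinity, used to kill the boundary terms of the fundamental theorem of
    calculus. *)
Lemma normal_pdf_sqrt2_ub x :
  Num.sqrt 2 * normal_pdf m (Num.sqrt 2) x <=
  Num.sqrt 2 * normal_peak (Num.sqrt 2) * expR (1 + `|m|) * expR (- `|x|).
Proof.
have s20 : Num.sqrt 2 != 0 :> R by rewrite gt_eqF// sqrtr_gt0.
rewrite normal_pdfE// /normal_fun sqr_sqrtr// -!mulrA ler_wpM2l//.
rewrite ler_wpM2l ?normal_peak_ge0// -expRD ler_expR.
have h1 : `|x| <= `|x - m| + `|m| by rewrite -{1}(subrK m x) ler_normD.
have h2 : (x - m) ^+ 2 = `|x - m| ^+ 2 by rewrite real_normK ?num_real.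
rewrite mulNr h2; set y := `|x - m| in h1 *.
have := sqr_ge0 (y / 2 - 1); nra.
Qed.

Lemma hpoly_pdf_ub k : exists2 C, 0 <= C &
  forall x, `|(hpoly k).[x] * normal_pdf m 1 x| <=
            C * (Num.sqrt 2 * normal_pdf m (Num.sqrt 2) x).
Proof.
have [C C0 HC] := hpoly_expR_ub m k; exists C => // x.
rewrite normrM (ger0_norm (normal_pdf_ge0 _ _ _)) -expR_sqr_normal_pdf mulrA.
by rewrite ler_wpM2r ?normal_pdf_ge0.
Qed.

Lemma integrable_hpoly_pdf k :
  mu.-integrable setT (EFin \o (fun x => (hpoly k).[x] * normal_pdf m 1 x)).
Proof.
have [C C0 HC] := hpoly_pdf_ub k.
apply: (@le_integrable _ _ _ mu _ measurableT _ (fun x => (C * Num.sqrt 2)%:E *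
   (normal_pdf m (Num.sqrt 2) x)%:E)%E).
- apply/measurable_EFinP; apply: measurable_funM.
    apply: continuous_measurable_fun; exact: continuous_horner.
  exact: measurable_normal_pdf.
- move=> x _ /=; rewrite lee_fin (le_trans (HC x))// mulrA ger0_norm//.
  by rewrite !mulr_ge0// normal_pdf_ge0.
- by apply: integrableZl => //; exact: integrable_normal_pdf.
Qed.

(** The density contributes [-(x - m)]; since [x H_k - H_k'] is [H_{k+1}], only [m H_k] is left
    over. *)
Lemma is_derive_hpoly_pdf k (x : R) :
  is_derive x (1 : R) (fun x : R => (hpoly k).[x] * normal_pdf m 1 x)
   (m * ((hpoly k).[x] * normal_pdf m 1 x) -
     (hpoly k.+1).[x] * normal_pdf m 1 x).
Proof.
have dpdf : is_derive x (1 : R) (normal_pdf m 1 : R -> R)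
    (- (x - m) * normal_pdf m 1 x).
  rewrite normal_pdfE ?oner_eq0// /normal_fun.
  apply: is_derive_eq; rewrite /GRing.scale/=.
  move: (expR _) (normal_peak _) => e p; by field.
have dp := is_derive_poly (hpoly k) x.
apply: (@is_derive_eq _ _ _ (horner (hpoly k) * normal_pdf m 1)).
rewrite /GRing.scale/= hornerD hornerN hornerM hornerX.
move: (normal_pdf _ _ _) ((hpoly k).[x]) ((hpoly k)^`().[x]) => a b b'; ring.
Qed.

(** The integrand is the derivative of [H_k] times the density, which vanishes at infinity. The
    integrals over growing symmetric intervals tend both to the full integral, by dominated
    convergence, and to [0]. *)
Lemma integral_hpolyS_pdf k :
  (\int[mu]_x (m * ((hpoly k).[x] * normal_pdf m 1 x) -
     (hpoly k.+1).[x] * normal_pdf m 1 x)%:E = 0)%E.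
Proof.
pose f (x : R) := m * ((hpoly k).[x] * normal_pdf m 1 x) -
  (hpoly k.+1).[x] * normal_pdf m 1 x.
rewrite -[LHS]/(\int[mu]_x (f x)%:E)%E.
pose F := fun x : R => (hpoly k).[x] * normal_pdf m 1 x.
have dF (x : R) : is_derive x (1 : R) F (f x) by exact: is_derive_hpoly_pdf.
have cF : continuous F.
  move=> x; apply/differentiable_continuous/derivable1_diffP.
  by have [] := dF x.
have cf : continuous f.
  move=> x; apply: cvgB; first by apply: cvgM; [exact: cvg_cst|exact: cF].
  apply: cvgM; first exact: continuous_horner.
  exact: (continuous_normal_pdf (oner_neq0 _)).
have intf : mu.-integrable setT (EFin \o f).
  rewrite (_ : _ \o _ = ((fun x => m%:E * (EFin \o F) x) \-
     (EFin \o (fun x : R => (hpoly k.+1).[x] * normal_pdf m 1 x)%R))%E)//.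
  apply: integrableB => //; last exact: integrable_hpoly_pdf.
  by apply: integrableZl => //; exact: integrable_hpoly_pdf.
(* The successor keeps the interval nondegenerate for [n = 0], as [continuous_FTC2] requires. *)
pose A n : set R := `[- n.+1%:R, n.+1%:R]%classic.
have FTC n : (\int[mu]_(x in A n) (f x)%:E = (F n.+1%:R - F (- n.+1%:R))%:E)%E.
  have n0 : - n.+1%:R < n.+1%:R :> R by rewrite gtrN// ltr0n.
  rewrite EFinB; apply: (continuous_FTC2 n0).
  - by apply: continuous_subspaceT => x; exact: cf.
  - split => [x _||]; first by have [] := dF x.
    + exact/cvg_at_right_filter/cF.
    + exact/cvg_at_left_filter/cF.
  - by move=> x _; rewrite derive1E; exact: derive_val.
have mA n : measurable (A n) by exact: measurable_itv.
have AE : (fun n => \int[mu]_(x in A n) (f x)%:E)%E =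
    (fun n => \int[mu]_x ((EFin \o f) \_ (A n)) x)%E.
  by apply/funext => n; rewrite integral_mkcond.
have cvg1 : (fun n => \int[mu]_(x in A n) (f x)%:E)%E @ \oo -->
    (\int[mu]_x (f x)%:E)%E.
  have := @dominated_convergence _ _ _ mu setT measurableT
    (fun n => (EFin \o f) \_ (A n)) (EFin \o f) (abse \o (EFin \o f)).
  case.
  - move=> n; apply/(measurable_restrictT _ (mA n)).
    by apply: measurable_funTS; exact: measurable_int intf.
  - exact: measurable_int intf.
  - apply: aeW => x _; apply: cvg_near_cst.
    exists (Num.truncn `|x|) => // n /= xn; rewrite patchE mem_set//.
    rewrite /A/= in_itv/= -ler_norml; apply/ltW.
    apply: lt_le_trans (truncnS_gt `|x|) _.
    by rewrite ler_nat ltnS.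
  - exact: integrable_abse.
  - apply: aeW => x n _; rewrite patchE; case: ifPn => //= _.
    by rewrite normr0 lee_fin.
  by move=> _ _; rewrite AE.
have cvg0 : (fun n => \int[mu]_(x in A n) (f x)%:E)%E @ \oo --> 0%E.
  under eq_fun do rewrite FTC.
  apply: cvg_EFin; first exact: nearW.
  have [C C0 HC] := hpoly_pdf_ub k.
  pose D := C * (Num.sqrt 2 * normal_peak (Num.sqrt 2) * expR (1 + `|m|)).
  have HF x : `|F x| <= D * expR (- `|x|).
    apply: le_trans (HC x) _; rewrite -mulrA; apply: ler_wpM2l => //.
    exact: normal_pdf_sqrt2_ub.
  have H n : `|F n.+1%:R - F (- n.+1%:R)| <= 2 * D * expR (- n%:R).
    have D0 : 0 <= D.
      by rewrite !mulr_ge0// ?normal_peak_ge0 ?expR_ge0.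
    have e0 : expR (- n.+1%:R) <= expR (- n%:R) :> R.
      by rewrite ler_expR lerN2 ler_nat.
    apply: le_trans (ler_normB _ _) _.
    have h1 := HF n.+1%:R; have h2 := HF (- n.+1%:R).
    move: h1 h2; rewrite normrN normr_nat => h1 h2.
    have h3 := ler_wpM2l D0 e0.
    by rewrite -mulrA; lra.
  apply/norm_cvg0P; apply: (@squeeze_cvgr _ _ _ _ (fun=> 0) (fun n => 2 * D * expR (- n%:R))).
  - by apply: nearW => n /=; rewrite normr_ge0 H.
  - exact: cvg_cst.
  - rewrite -[X in _ --> X](mulr0 (2 * D)); apply: cvgM; first exact: cvg_cst.
    exact: cvgn_expR.
exact: cvg_unique cvg1 cvg0.
Qed.

(** By the vanishing integral above, the mean of [H_{k+1}] is [m] times that of [H_k]. This is what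
    makes Hermite sums unbiased estimators of polynomials. *)
Lemma integral_hpoly k :
  (\int[normal_prob m 1]_x ((hpoly k).[x])%:E = (m ^+ k)%:E)%E.
Proof.
rewrite (integral_normal_prob (integrable_hpoly m k)).
elim: k => [|k IH].
  by under eq_integral do rewrite hornerC mul1r; rewrite integral_normal_pdf.
have := integral_hpolyS_pdf k; under eq_integral do rewrite EFinB EFinM.
rewrite integralB//; last 2 first.
- by apply: integrableZl => //; exact: integrable_hpoly_pdf.
- exact: integrable_hpoly_pdf.
rewrite integralZl//; last exact: integrable_hpoly_pdf.
have fin := integrable_fin_num measurableT (integrable_hpoly_pdf k.+1).
rewrite IH -EFinM -exprS -(fineK fin) -EFinB => -[/eqP].
by rewrite subr_eq0 => /eqP ->.
Qed.

End hermite_mean.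

(** * Independence and risk of a sum of uncorrelated variables *)

Section independence.
Context d (T : measurableType d) (R : realType) (P : probability T R).

Local Notation "'E[ f ]" := (\int[P]_w f w) (at level 0, f at level 99).
Local Notation integ f := (P.-integrable [set: T] (EFin \o f)).

Definition independent2 (U V : T -> R) := forall A B : set R,
  measurable A -> measurable B ->
  P (U @^-1` A `&` V @^-1` B) = (P (U @^-1` A) * P (V @^-1` B))%E.

(** The joint law agrees with the product of the marginals on rectangles, hence everywhere by
    uniqueness of the product measure; Fubini then factors the expectation. *)
Lemma independent2_expectation (U V : T -> R) :
  integ U -> integ V -> independent2 U V ->
  integ (fun w => U w * V w) /\ 'E[fun w => U w * V w] = 'E[U] * 'E[V].
Proof.
move=> iU iV UV.
have mU : measurable_fun [set: T] U by exact/measurable_EFinP/(measurable_int _ iU).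
have mV : measurable_fun [set: T] V by exact/measurable_EFinP/(measurable_int _ iV).
have mZ : measurable_fun [set: T] (fun w => (U w, V w)).
  exact/measurable_fun_pair.
pose pX := isMeasurableFun.Build _ _ _ _ U mU.
pose pY := isMeasurableFun.Build _ _ _ _ V mV.
pose pZ := isMeasurableFun.Build _ _ _ _ (fun w => (U w, V w)) mZ.
pose X : {mfun T >-> R} := HB.pack U pX.
pose Y : {mfun T >-> R} := HB.pack V pY.
pose Z : {mfun T >-> (R * R)%type} := HB.pack (fun w => (U w, V w)) pZ.
pose m1 := distribution P X; pose m2 := distribution P Y.
have prodE (S : set (R * R)) : measurable S -> (m1 \x m2)%E S = distribution P Z S.
  by apply: product_measure_unique => A B mA mB; exact: UV.
pose f (z : R * R) : \bar R := (z.1 * z.2)%:E.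
have mf : measurable_fun [set: R * R] f by apply/measurable_EFinP; exact: measurable_funM.
have m1abs : (\int[m1]_x `|x%:E| < +oo)%E.
  move/integrableP : iU => [_]; rewrite /m1 ge0_integral_distribution//.
  by apply: measurableT_comp => //; exact/measurable_EFinP.
have m2abs : (\int[m2]_x `|x%:E| < +oo)%E.
  move/integrableP : iV => [_]; rewrite /m2 ge0_integral_distribution//.
  by apply: measurableT_comp => //; exact/measurable_EFinP.
have intm1 : m1.-integrable setT (EFin : R -> \bar R).
  by apply/integrableP; split => //; exact/measurable_EFinP.
have intm2 : m2.-integrable setT (EFin : R -> \bar R).
  by apply/integrableP; split => //; exact/measurable_EFinP.
have intf : (m1 \x m2)%E.-integrable setT f.
  apply/integrable12ltyP => //.
  rewrite (_ : (fun x => _) = fun x => `|x%:E| * \int[m2]_y `|y%:E|)%E; last first.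
    apply/funext => x; rewrite -ge0_integralZl//; last first.
      by apply: measurableT_comp => //; exact/measurable_EFinP.
    by apply: eq_integral => y _; rewrite /f/= normrM EFinM.
  rewrite ge0_integralZr//; last 2 first.
  - by apply: measurableT_comp => //; exact/measurable_EFinP.
  - exact: integral_ge0.
  rewrite lte_mul_pinfty//; first exact: integral_ge0.
  by rewrite ge0_fin_numE//; exact: integral_ge0.
have eqZ g : (\int[distribution P Z]_z g z = \int[m1 \x m2]_z g z)%E.
  apply: eq_measure_integral => S mS _; exact/esym/prodE.
have iUV : integ (fun w => U w * V w).
  apply/integrableP; split; first by apply/measurable_EFinP; exact: measurable_funM.
  have /integrableP[_] := intf; rewrite -eqZ ge0_integral_distribution//.
  exact: measurableT_comp.
split=> //; rewrite /Rintegral -fineM; last 2 first.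
- exact: integrable_fin_num.
- exact: integrable_fin_num.
congr fine; transitivity (\int[distribution P Z]_z f z)%E.
  by rewrite integral_distribution.
rewrite eqZ -integral12_prod_meas1//.
have -> : (\int[P]_w (U w)%:E = \int[m1]_x x%:E)%E.
  by rewrite /m1 integral_distribution//; exact/measurable_EFinP.
have -> : (\int[P]_w (V w)%:E = \int[m2]_x x%:E)%E.
  by rewrite /m2 integral_distribution//; exact/measurable_EFinP.
have fin2 := integrable_fin_num measurableT intm2.
rewrite -(fineK fin2) -integralZr//.
apply: eq_integral => x _; rewrite (fineK fin2) -integralZl//.
Qed.
(** Restriction sends the complement of [E] to the value [0]. If [0] is not in [B], the preimage of
    [B] lies inside [E] and the hypothesis applies; otherwise one passes to the complement of
    [B]. *)
Lemma independent2_restrict (U V : T -> R) (E : set T) :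
  measurable_fun [set: T] U -> measurable_fun [set: T] V -> measurable E ->
  (forall A B : set R, measurable A -> measurable B ->
    P (U @^-1` A `&` V @^-1` B `&` E) = (P (U @^-1` A) * P (V @^-1` B `&` E))%E) ->
  independent2 U (fun w => V w * \1_E w).
Proof.
move=> mU mV mE UVE.
have mVE : measurable_fun [set: T] (fun w => V w * \1_E w).
  by apply: measurable_funM => //; exact: measurable_indic.
have mpre (f : T -> R) (B : set R) : measurable_fun [set: T] f -> measurable B ->
    measurable (f @^-1` B).
  by move=> mf mB; rewrite -[X in measurable X]setTI; exact: mf.
have noz (A B : set R) : measurable A -> measurable B -> ~ B 0 ->
    P (U @^-1` A `&` (fun w => V w * \1_E w) @^-1` B) =
    (P (U @^-1` A) * P ((fun w => V w * \1_E w)%R @^-1` B))%E.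
  move=> mA mB B0.
  have -> : (fun w => V w * \1_E w) @^-1` B = V @^-1` B `&` E.
    apply/seteqP; split => w /=; rewrite indicE; have [wE|wE] := boolP (w \in E).
    - by rewrite mulr1 => ?; split => //; exact/set_mem.
    - by rewrite mulr0.
    - by rewrite mulr1 => -[].
    - by move=> [_ /mem_set]; rewrite (negbTE wE).
  by rewrite setIA UVE.
move=> A B mA mB; have [B0|] := pselect (B 0); last exact: noz.
have mCB := measurableC mB.
have := noz A (~` B) mA mCB (fun h => h B0).
set W := (fun w => V w * \1_E w) @^-1` B.
have mW : measurable W by exact: mpre.
have mUA : measurable (U @^-1` A) by exact: mpre.
rewrite -[_ @^-1` (~` B)]/(~` W) => H.
have finP (S : set T) : measurable S -> P S = (fine (P S))%:E.
  by move=> mS; rewrite fineK// fin_num_measure.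
have e1 : (P (U @^-1` A) = P (U @^-1` A `&` W) + P (U @^-1` A `&` ~` W))%E.
  rewrite -measureU//; [|exact: measurableI|by apply: measurableI => //; exact: measurableC|].
    by rewrite -setIUr setUv setIT.
  by rewrite setIACA setIid setICr setI0.
have e2 := probability_setC P mW.
move: H e1; rewrite e2 (finP _ mUA) (finP _ mW) (finP _ (measurableI _ _ mUA mW)).
rewrite (finP _ (measurableI _ _ mUA (measurableC mW))) -!EFinB -!EFinM -EFinD.
move=> [] h1 [] h2; congr EFin; lra.
Qed.

(** The indicator of [E] is the constant [1] restricted to [E], so [independent2_restrict] applies
    to it. *)
Lemma expectation_restrict (V : T -> R) (E : set T) : integ V -> measurable E ->
  (forall B : set R, measurable B -> P (V @^-1` B `&` E) = (P (V @^-1` B) * P E)%E) ->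
  integ (fun w => V w * \1_E w) /\
  'E[fun w => V w * \1_E w] = 'E[V] * fine (P E).
Proof.
move=> iV mE VE.
have mV : measurable_fun [set: T] V by exact/measurable_EFinP/(measurable_int _ iV).
have ind : independent2 V (fun w => cst 1 w * \1_E w).
  apply: independent2_restrict => // A B mA mB.
  rewrite preimage_cst; case: ifP => _.
    by rewrite setIT setTI VE.
  by rewrite setI0 !set0I measure0 mule0.
have i1 : integ (fun w => cst 1 w * \1_E w).
  rewrite (_ : (fun w => _) = \1_E); first exact: integrable_indic.
  by apply/funext => w; rewrite mul1r.
have [] := independent2_expectation iV i1 ind.
have -> : (fun w => V w * (cst 1 w * \1_E w)) = (fun w => V w * \1_E w).
  by apply/funext => w; rewrite mul1r.
move=> iVE ->; split=> //; congr (_ * _).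
under eq_Rintegral do rewrite mul1r.
by rewrite /Rintegral integral_indic// setIT.
Qed.

Lemma expectationM_restrict (U V : T -> R) (E : set T) :
  integ U -> integ V -> measurable E ->
  (forall A B : set R, measurable A -> measurable B ->
    P (U @^-1` A `&` V @^-1` B `&` E) =
    (P (U @^-1` A) * (P (V @^-1` B) * P E))%E) ->
  integ (fun w => U w * (V w * \1_E w)) /\
  'E[fun w => U w * (V w * \1_E w)] = 'E[U] * ('E[V] * fine (P E)).
Proof.
move=> iU iV mE UVE.
have mU : measurable_fun [set: T] U by exact/measurable_EFinP/(measurable_int _ iU).
have mV : measurable_fun [set: T] V by exact/measurable_EFinP/(measurable_int _ iV).
have VE (B : set R) : measurable B -> P (V @^-1` B `&` E) = (P (V @^-1` B) * P E)%E.
  move=> mB; have := UVE setT B measurableT mB.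
  by rewrite preimage_setT setTI probability_setT mul1e.
have [iVE <-] := expectation_restrict iV mE VE.
apply: independent2_expectation => //.
apply: independent2_restrict => // A B mA mB.
by rewrite UVE// VE.
Qed.

End independence.

(** * Expectation and quadratic risk of finite sums *)

Section finite_sums.
Context d (T : measurableType d) (R : realType) (P : probability T R).

Local Notation "'E[ f ]" := (\int[P]_w f w) (at level 0, f at level 99).
Local Notation integ f := (P.-integrable [set: T] (EFin \o f)).

Lemma Rintegral_bigsum (I : Type) (r : seq I) (F : I -> T -> R) :
  (forall i, integ (F i)) ->
  integ (fun w => \sum_(i <- r) F i w) /\
  'E[fun w => \sum_(i <- r) F i w] = \sum_(i <- r) 'E[F i].
Proof.
move=> iF; elim: r => [|i r [IH1 IH2]].
  split.
    rewrite (_ : (fun w => _) = cst 0); last by apply/funext => w; rewrite big_nil.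
    exact: finite_measure_integrable_cst.
  rewrite big_nil; under eq_Rintegral do rewrite big_nil.
  by rewrite Rintegral_cst// mul0r.
have -> : (fun w => \sum_(j <- i :: r) F j w) =
    (fun w => F i w + \sum_(j <- r) F j w).
  by apply/funext => w; rewrite big_cons.
split; first exact: (integrableD measurableT (iF i) IH1).
by rewrite RintegralD// IH2 big_cons.
Qed.

Lemma integrableZ_EFin (a : R) (F : T -> R) : integ F -> integ (fun w => a * F w).
Proof. by move=> iF; exact: (integrableZl measurableT a iF). Qed.

(** Squared bias plus variance, each variance being enlarged to a second moment: off-diagonal pairs
    match exactly, and on the diagonal the squared mean is only a nonnegative surplus. *)
Lemma uncorrelated_risk_le (I : finType) (F : I -> T -> R) (tau : R) :
  (forall i, integ (F i)) -> (forall i j, integ (fun w => F i w * F j w)) ->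
  (forall i j, i != j -> 'E[fun w => F i w * F j w] = 'E[F i] * 'E[F j]) ->
  integ (fun w => (\sum_i F i w - tau) ^+ 2) /\
  'E[fun w => (\sum_i F i w - tau) ^+ 2] <=
    (\sum_i 'E[F i] - tau) ^+ 2 + \sum_i 'E[fun w => F i w ^+ 2].
Proof.
move=> iF iFF unc.
have [iS eS] := Rintegral_bigsum (index_enum I) iF.
pose G (ij : I * I) w := F ij.1 w * F ij.2 w.
have [iQ eQ] := Rintegral_bigsum (index_enum _) (fun ij => iFF ij.1 ij.2 : integ (G ij)).
have SS w : (\sum_i F i w) ^+ 2 = \sum_ij G ij w.
  by rewrite expr2 big_distrlr/= pair_bigA.
have expand : (fun w => (\sum_i F i w - tau) ^+ 2) =
    (fun w => \sum_ij G ij w + (- 2 * tau) * \sum_i F i w + tau ^+ 2).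
  by apply/funext => w; rewrite -SS; ring.
have i2 := integrableZ_EFin (- 2 * tau) iS.
have i3 : integ (fun _ => tau ^+ 2) by exact: finite_measure_integrable_cst.
have i12 : integ (fun w => \sum_ij G ij w + (- 2 * tau) * \sum_i F i w).
  exact: (integrableD measurableT iQ i2).
rewrite expand; split; first exact: (integrableD measurableT i12 i3).
rewrite RintegralD// RintegralD// RintegralZl// Rintegral_cst// eQ eS.
rewrite [X in fine X]probability_setT mulr1.
set mu := fun i => 'E[F i].
have : \sum_ij 'E[G ij] <= (\sum_i mu i) ^+ 2 + \sum_i 'E[fun w => F i w ^+ 2].
  have -> : (\sum_i mu i) ^+ 2 = \sum_ij mu ij.1 * mu ij.2.
    by rewrite expr2 big_distrlr/= pair_bigA.
  have -> : \sum_i 'E[fun w => F i w ^+ 2] =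
     \sum_ij (if ij.1 == ij.2 then 'E[fun w => F ij.1 w ^+ 2] else 0).
    rewrite -(pair_bigA _ (fun i j => if i == j then 'E[fun w => F i w ^+ 2] else 0))/=.
    by apply: eq_bigr => i _; rewrite -big_mkcond/= (big_pred1 i)// => j; rewrite eq_sym.
  rewrite -big_split/=; apply: ler_sum => -[i j] _ /=.
  case: eqVneq => [<-|ij]; last by rewrite addr0 unc.
  rewrite -[leLHS]add0r lerD//.
    by rewrite -expr2 sqr_ge0.
rewrite /mu => h; lra.
Qed.

End finite_sums.

(** * Factorization of expectations over the two Gaussian copies *)

Section sample.
Context d (T : measurableType d) (R : realType) (P : probability T R).
Variables (n : nat) (theta : 'rV[R]_n) (y1 y2 : 'I_n -> {mfun T >-> R}).
Hypothesis sample : gaussian_sample P theta y1 y2.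

Local Notation "'E[ f ]" := (\int[P]_w f w) (at level 0, f at level 99).
Local Notation integ f := (P.-integrable [set: T] (EFin \o f)).
Local Notation N i := (normal_prob (theta ord0 i) 1).

Let law1 i (A : set R) : measurable A -> P (y1 i @^-1` A) = N i A.
Proof. by case: sample => _ + _; exact. Qed.

Let law2 i (A : set R) : measurable A -> P (y2 i @^-1` A) = N i A.
Proof. by case: sample => _ _; exact. Qed.

Lemma sample_expectation i (f : R -> R) :
  (N i).-integrable setT (EFin \o f) ->
  integ (fun w => f (y1 i w)) /\
  'E[fun w => f (y1 i w)] = \int[N i]_x f x.
Proof.
move=> fi; have mf := measurable_int _ fi.
(* [normal_prob] lives on [measurableTypeR R], whose display differs from the
   default one of [R] although the sigma-algebras are the same. *)
have mY : measurable_fun [set: T] (y1 i : T -> measurableTypeR R).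
  have := measurable_funPT (y1 i). exact: id.
pose pY := isMeasurableFun.Build _ _ _ _ (y1 i : T -> measurableTypeR R) mY.
pose Y : {mfun T >-> measurableTypeR R} := HB.pack (y1 i : T -> measurableTypeR R) pY.
have eqD g : (\int[distribution P Y]_x g x = \int[N i]_x g x)%E.
  by apply: eq_measure_integral => A mA _; exact: law1.
have iP : integ (fun w => f (y1 i w)).
  apply/integrableP; split.
    exact: (measurableT_comp mf mY).
  have /integrableP[_] := fi; rewrite -eqD ge0_integral_distribution//.
  exact: measurableT_comp.
split=> //; rewrite /Rintegral; congr fine.
by rewrite -eqD integral_distribution.
Qed.

Let meas_pre (X : {mfun T >-> R}) (A : set R) : measurable A -> measurable (X @^-1` A).
Proof. by move=> mA; rewrite -[X in measurable X]setTI; exact: measurable_funP. Qed.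

Let X (k : 'I_n + 'I_n) : T -> R :=
  match k with inl i => y1 i : T -> R | inr i => y2 i : T -> R end.

Let indep : mutually_independent P X.
Proof. by case: sample. Qed.

Lemma sample_indep2 i (A B : set R) : measurable A -> measurable B ->
  P (y1 i @^-1` A `&` y2 i @^-1` B) =
  (P (y1 i @^-1` A) * P (y2 i @^-1` B))%E.
Proof.
move=> mA mB.
pose S (k : 'I_n + 'I_n) := if k is inl _ then A else B.
have := indep (inl i |: [set inr i])%SET (A := S).
rewrite big_setU1 ?inE//= big_set1 => <-; last by case.
congr (P _); apply/seteqP; split => w /=.
  by move=> [wA wB] k /=; rewrite !inE => /orP[] /eqP ->.
by move=> H; split; [apply: (H (inl i))|apply: (H (inr i))]; rewrite /= !inE eqxx ?orbT.
Qed.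

(** Mutual independence at the four indices [inl i], [inl j], [inr i], [inr j], the four sets being
    the values of one family [S]. *)
Lemma sample_indep4 i j (A B C D : set R) : i != j ->
  measurable A -> measurable B -> measurable C -> measurable D ->
  P (y1 i @^-1` A `&` y1 j @^-1` B `&` (y2 i @^-1` C `&` y2 j @^-1` D)) =
  (P (y1 i @^-1` A) * (P (y1 j @^-1` B) *
    (P (y2 i @^-1` C) * P (y2 j @^-1` D))))%E.
Proof.
move=> ij mA mB mC mD; have ji : j == i = false by rewrite eq_sym; apply/negbTE.
pose S (k : 'I_n + 'I_n) := match k with
  | inl k => if k == i then A else B | inr k => if k == i then C else D end.
have := indep (inl i |: (inl j |: (inr i |: [set inr j])))%SET (A := S).
rewrite big_setU1 ?inE//=; last by rewrite /eq_op/= (negbTE ij).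
rewrite big_setU1 ?inE//= big_setU1 ?inE//=.
rewrite big_set1 /= !eqxx ji => <-; last by case=> k /=; case: ifP.
congr (P _); apply/seteqP; split => w /=.
  move=> [[wA wB] [wC wD]] k /=; rewrite !inE => /orP[/eqP->|]; first by rewrite /= eqxx.
  move=> /orP[/eqP->|]; first by rewrite /= ji.
  by move=> /orP[/eqP->|/eqP->] /=; rewrite ?eqxx ?ji.
move=> H; have Hk k : k \in (inl i |: (inl j |: (inr i |: [set inr j])))%SET -> S k (X k w).
  by move=> kin; exact: H.
split; split.
- by have := Hk (inl i); rewrite !inE !eqxx /= eqxx; exact.
- by have := Hk (inl j); rewrite !inE !eqxx ?orbT /= ji; exact.
- by have := Hk (inr i); rewrite !inE !eqxx ?orbT /= eqxx; exact.
- by have := Hk (inr j); rewrite !inE !eqxx ?orbT /= ji; exact.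
Qed.

Lemma sample_expectation1 i (f : R -> R) (A : set R) :
  (N i).-integrable setT (EFin \o f) -> measurable A ->
  integ (fun w => f (y1 i w) * \1_A (y2 i w)) /\
  'E[fun w => f (y1 i w) * \1_A (y2 i w)] = (\int[N i]_x f x) * fine (N i A).
Proof.
move=> fi mA; have [iP <-] := sample_expectation fi.
have /measurable_EFinP mf := measurable_int _ fi.
have [] := expectation_restrict iP (meas_pre (y2 i) mA).
  move=> B mB; have mfB : measurable (f @^-1` B : set R).
    by rewrite -[X in measurable X]setTI; exact: mf.
  exact: (sample_indep2 i mfB mA).
by rewrite [P _]law2.
Qed.

(** The two indicators multiply to that of one event [E] of the second copies, which is independent
    of the pair of first copies. *)
Lemma sample_expectation2 i j (f g : R -> R) (A B : set R) : i != j ->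
  (N i).-integrable setT (EFin \o f) -> (N j).-integrable setT (EFin \o g) ->
  measurable A -> measurable B ->
  'E[fun w => f (y1 i w) * \1_A (y2 i w) * (g (y1 j w) * \1_B (y2 j w))] =
  (\int[N i]_x f x) * fine (N i A) * ((\int[N j]_x g x) * fine (N j B)).
Proof.
move=> ij fi gj mA mB.
have [iP <-] := sample_expectation fi; have [jP <-] := sample_expectation gj.
have /measurable_EFinP mf := measurable_int _ fi.
have /measurable_EFinP mg := measurable_int _ gj.
pose E := y2 i @^-1` A `&` y2 j @^-1` B.
have pre (h : R -> R) (S : set R) : measurable_fun [set: R] h -> measurable S ->
    measurable (h @^-1` S).
  by move=> mh mS; rewrite -[X in measurable X]setTI; exact: mh.
(* Taking the whole line for both first copies leaves the independence of the second ones. *)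
have PE : P E = (P (y2 i @^-1` A) * P (y2 j @^-1` B))%E.
  have := sample_indep4 ij measurableT measurableT mA mB.
  by rewrite !preimage_setT !setTI probability_setT !mul1e.
have mE : measurable E by apply: measurableI; exact: meas_pre.
have hyp (S S' : set R) : measurable S -> measurable S' ->
    P ((fun w => f (y1 i w)) @^-1` S `&` (fun w => g (y1 j w)) @^-1` S' `&` E) =
    (P ((fun w => f (y1 i w)) @^-1` S) * (P ((fun w => g (y1 j w)) @^-1` S') * P E))%E.
  move=> mS mS'; rewrite PE.
  exact: (sample_indep4 ij (pre _ _ mf mS) (pre _ _ mg mS') mA mB).
have [_ H] := expectationM_restrict iP jP mE hyp.
move: H; rewrite PE (law2 _ mA) (law2 _ mB) fineM ?fin_num_measure// => H.
transitivity ('E[fun w => f (y1 i w) * (g (y1 j w) * \1_E w)]).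
  apply: eq_Rintegral => w _; rewrite /E indicI /= mulrACA -mulrA.
  by congr (_ * (_ * _)).
by rewrite H; ring.
Qed.

End sample.

(** * Coefficients of polynomials bounded on an interval *)

Section coefficient_bound.
Context {R : realType}.
Implicit Types (p q : {poly R}) (x : R).

(** Coefficientwise majorants are stable under sums and products, so the coefficients of Lagrange
    polynomials can be bounded without being expanded. *)
Definition dominated_coef p q := forall i, `|p`_i| <= q`_i.

Lemma dominated_coefM p q p' q' :
  dominated_coef p q -> dominated_coef p' q' -> dominated_coef (p * p') (q * q').
Proof.
move=> pq pq' i; rewrite !coefM; apply: le_trans (ler_norm_sum _ _ _) _.
by apply: ler_sum => j _; rewrite normrM ler_pM.
Qed.

Lemma dominated_coefD p q p' q' :
  dominated_coef p q -> dominated_coef p' q' -> dominated_coef (p + p') (q + q').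
Proof.
by move=> pq pq' i; rewrite !coefD (le_trans (ler_normD _ _))// lerD.
Qed.

Lemma dominated_coefC (a b : R) : `|a| <= b -> dominated_coef a%:P b%:P.
Proof. by move=> ab i; rewrite !coefC; case: ifP => // _; rewrite normr0. Qed.

Lemma dominated_coefXsubC (a : R) : dominated_coef ('X - a%:P) ('X + `|a|%:P).
Proof.
apply: dominated_coefD; first by move=> i; rewrite coefX normr_nat.
by move=> i; rewrite coefN normrN; exact: dominated_coefC.
Qed.

Lemma dominated_coef_sum (I : Type) (r : seq I) (P : pred I) (F G : I -> {poly R}) :
  (forall i, dominated_coef (F i) (G i)) ->
  dominated_coef (\sum_(i <- r | P i) F i) (\sum_(i <- r | P i) G i).
Proof.
move=> FG; elim/big_ind2: _ => //; first by move=> i; rewrite coef0 normr0.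
by move=> *; exact: dominated_coefD.
Qed.

Lemma dominated_coef_prod (I : Type) (r : seq I) (P : pred I) (F G : I -> {poly R}) :
  (forall i, dominated_coef (F i) (G i)) ->
  dominated_coef (\prod_(i <- r | P i) F i) (\prod_(i <- r | P i) G i).
Proof.
move=> FG; elim/big_ind2: _ => //.
  by rewrite -polyC1; apply: dominated_coefC; rewrite normr1.
by move=> *; exact: dominated_coefM.
Qed.

(** The coefficients of [q] are nonnegative, so those beyond rank [n] only enlarge [q.[M]]. *)
Lemma dominated_coef_horner p q n (M : R) : 0 <= M -> dominated_coef p q ->
  \sum_(i < n) `|p`_i| * M ^+ i <= q.[M].
Proof.
move=> M0 pq; set N := maxn n (size q).
rewrite (horner_coef_wide M (leq_maxr n (size q))) -/N.
rewrite (big_ord_widen N (fun i => `|p`_i| * M ^+ i)) ?leq_maxl// big_mkcond/=.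
apply: ler_sum => i _; case: ifP => _; first by rewrite ler_wpM2r ?exprn_ge0.
by rewrite mulr_ge0 ?exprn_ge0// (le_trans _ (pq i)).
Qed.

(** Nodes below [j] contribute [j!] and those above [(n - j)!]. Up to scaling, this is the Lagrange
    denominator at equispaced nodes. *)
Lemma prod_dist_fact n (j : 'I_n.+1) :
  \prod_(m < n.+1 | m != j) `|(j%:R - m%:R : R)| = (j`! * (n - j)`!)%:R.
Proof.
rewrite -(big_mkord (fun m => m != j :> nat) (fun m => `|j%:R - m%:R : R|)).
have jn : (j <= n)%N by rewrite -ltnS.
rewrite (big_cat_nat (n := j))//=; last exact: leqW.
rewrite (big_ltn_cond (m := j)) ?ltnS// eqxx/= natrM; congr (_ * _).
  rewrite fact_prod natr_prod big_add1/= big_nat_rev/= add0n.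
  rewrite big_nat_cond [RHS]big_nat_cond; apply: eq_big => i.
    by case: (ltnP i j) => //= ij; lia.
  move=> /andP[/andP[_ ij] _]; rewrite -natrB; last by lia.
  by rewrite normr_nat; congr (_%:R); lia.
rewrite fact_prod natr_prod -{1}[j.+1]add1n -[in X in \big[_/_]_(_ <= _ < X | _) _](subnK jn).
rewrite -addSn big_addn addnK.
rewrite big_nat_cond [RHS]big_nat_cond; apply: eq_big => i.
  by case: (ltnP 0 i) => //= ij; lia.
move=> /andP[/andP[_ ij] _]; rewrite distrC -natrB; last by lia.
by rewrite normr_nat; congr (_%:R); lia.
Qed.

(* Lagrange interpolation at the nodes [j M / n], [0 <= j <= n]. *)
Lemma coef_sum_le p n (M A : R) : 0 < M -> (size p <= n.+1)%N ->
  (forall x, `|x| <= M -> `|p.[x]| <= A) ->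
  \sum_(i < n.+1) `|p`_i| * M ^+ i <= A * expR (3 * n%:R).
Proof.
move=> M0 sp pA; have A0 : 0 <= A.
  by apply: le_trans (normr_ge0 _) (pA 0 _); rewrite normr0 ltW.
(* Degree [0] is treated apart: the mesh [M / n] would vanish and the nodes would coincide. *)
case: n sp => [|n] sp.
  rewrite big_ord1 expr0 mulr1 mulr0 expR0 mulr1 -horner_coef0.
  by apply: pA; rewrite normr0 ltW.
set N := n.+1 in sp *; pose h : R := M / N%:R.
have N0 : 0 < N%:R :> R by rewrite ltr0n.
have h0 : 0 < h by rewrite divr_gt0.
pose x (j : nat) : R := j%:R * h.
have xinj : injective x.
  move=> i j /eqP; rewrite /x -subr_eq0 -mulrBl mulf_eq0 (gt_eqF h0) orbF subr_eq0.
  by rewrite eqr_nat => /eqP.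
have xge0 j : 0 <= x j by rewrite mulr_ge0 ?(ltW h0).
have xM (j : 'I_N.+1) : x j <= M.
  rewrite /x /h mulrCA ger_pMr// ler_pdivrMr// mul1r ler_nat.
  by rewrite -ltnS.
pose c (j : 'I_N.+1) := (\prod_(m < N.+1 | m != j) ('X - (x m)%:P)).[x j].
have cE j : `|c j| = h ^+ N * (j`! * (N - j)`!)%:R.
  rewrite /c horner_prod normr_prod -prod_dist_fact.
  rewrite (eq_bigr (fun m : 'I__ => h * `|j%:R - m%:R|)); last first.
    move=> m _; rewrite !hornerE /x -mulrBl normrM mulrC.
    by rewrite (gtr0_norm h0).
  by rewrite big_split/= prodr_const cardC1 card_ord.
(* The majorant of the interpolation formula: values become [A], denominators their absolute values,
   and each [X - x m] becomes [X + x m]. *)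
pose Q : {poly R} := \sum_(j < N.+1) A%:P * ((`|c j|^-1)%:P *
   \prod_(m < N.+1 | m != j) ('X + `|x m|%:P)).
have pQ : dominated_coef p Q.
  rewrite [p](lagrange_gen (ltn0Sn N) xinj sp); apply: dominated_coef_sum => j.
  apply: dominated_coefM.
    by apply: dominated_coefC; apply: pA; rewrite ger0_norm.
  rewrite lagrangeE//; apply: dominated_coefM.
    by apply: dominated_coefC; rewrite normfV.
  by apply: dominated_coef_prod => m; exact: dominated_coefXsubC.
apply: le_trans (dominated_coef_horner _ (ltW M0) pQ) _.
rewrite /Q horner_sum.
(* At [M] each factor of the numerator is at most [2 M], and [j! (N - j)!] is [N!] over a binomial
   coefficient. *)
apply: (@le_trans _ _ (\sum_(j < N.+1) A * ((2 * N%:R) ^+ N / N`!%:R *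
    'C(N, j)%:R))).
  apply: ler_sum => j _; rewrite !hornerM !hornerC ler_wpM2l// horner_prod.
  have jN : (j <= N)%N by rewrite -ltnS.
  apply: (@le_trans _ _ (`|c j|^-1 * (2 * M) ^+ N)).
    rewrite ler_wpM2l ?invr_ge0//.
    apply: (@le_trans _ _ (\prod_(m < N.+1 | m != j) (2 * M))).
      apply: ler_prod => m _; rewrite !hornerE ger0_norm//.
      by apply/andP; split; [rewrite addr_ge0// ltW|have := xM m; lra].
    by rewrite prodr_const cardC1 card_ord.
  rewrite cE le_eqVlt; apply/orP; left; apply/eqP.
  rewrite -(bin_fact jN) !natrM !exprMn exprVn.
  have : (j`!%:R : R) != 0 by rewrite pnatr_eq0 -lt0n fact_gt0.
  have : ((N - j)`!%:R : R) != 0 by rewrite pnatr_eq0 -lt0n fact_gt0.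
  have : ('C(N, j)%:R : R) != 0 by rewrite pnatr_eq0 -lt0n bin_gt0.
  have : M ^+ N != 0 by rewrite expf_neq0// gt_eqF.
  have : (N%:R : R) ^+ N != 0 by rewrite expf_neq0// gt_eqF.
  move: (M ^+ N) (N%:R ^+ N) (2 ^+ N) ('C(N, j)%:R) ((N - j)`!%:R) (j`!%:R).
  by move=> a b e f g k *; field; do ?[apply/andP; split].
rewrite -!mulr_sumr; apply: ler_wpM2l => //.
have -> : \sum_(j < N.+1) ('C(N, j)%:R : R) = 2 ^+ N.
  have := expnDn 1 1 N; rewrite addn1 => /(congr1 (fun k => k%:R : R)).
  rewrite natrX => ->; rewrite natr_sum; apply: eq_bigr => i _.
  by rewrite !exp1n !muln1.
have f0 : (0 : R) < N`!%:R by rewrite ltr0n fact_gt0.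
(* The binomial sum gives a second [2 ^ N]; with [N ^ N / N!] this makes three factors, each at most
   [exp N], whence the exponent [3 N]. *)
have : (N%:R : R) ^+ N / N`!%:R <= expR N%:R.
  by rewrite ler_pdivrMr// mulrC; exact: expr_le_fact_expR.
have e2 : (2 : R) <= expR 1 by have := expR_ge1Dx (1 : R).
have p2 : (2 : R) ^+ N <= expR N%:R.
  rewrite -[N%:R]mulr1 expRM_natl; apply: lerXn2r => //; rewrite nnegrE ?expR_ge0//.
rewrite (_ : 3 * N%:R = N%:R + N%:R + N%:R :> R); last by ring.
rewrite !expRD exprMn.
move=> H; rewrite [leLHS](_ : _ = 2 ^+ N * 2 ^+ N * (N%:R ^+ N / N`!%:R)); last by ring.
have q0 : 0 <= (2 : R) ^+ N by rewrite exprn_ge0.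
apply: ler_pM; [exact: mulr_ge0| |exact: ler_pM|exact: H].
by rewrite divr_ge0// exprn_ge0.
Qed.

(** Passes from the radius [M] to any radius [y], using [t ^ i <= exp (n t^2 / 2)] for [t = y / M]
    and [i <= n]. The loss stays quadratic in [y] in the exponent. *)
Lemma rescaled_sum_le n (a : nat -> R) (M y : R) : 0 < M -> 0 <= y ->
  \sum_(i < n.+1) `|a i| * y ^+ i <=
  (\sum_(i < n.+1) `|a i| * M ^+ i) * expR (n%:R * ((y / M) ^+ 2 / 2)).
Proof.
move=> M0 y0; rewrite mulr_suml; apply: ler_sum => i _.
rewrite -mulrA ler_wpM2l//.
have -> : y ^+ i = M ^+ i * (y / M) ^+ i by rewrite -exprMn mulrC divfK ?gt_eqF.
apply: ler_wpM2l; first by rewrite exprn_ge0// ltW.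
apply: (@le_trans _ _ (expR ((y / M) ^+ 2 / 2) ^+ i)).
  apply: lerXn2r; rewrite ?nnegrE ?expR_ge0//; first by rewrite divr_ge0// ltW.
  exact: le_expR_half_sqr.
rewrite -expRM_natl ler_expR ler_wpM2r//.
  by rewrite divr_ge0// sqr_ge0.
by rewrite ler_nat -ltnS.
Qed.

End coefficient_bound.

(** * The estimator on one level *)

Section level.
Context {R : realType}.
Variables (F : R -> R) (p : {poly R}) (M c B delta : R).
Hypotheses (M0 : 0 < M) (c0 : 0 < c) (c1 : c <= 1 / 2).
Hypothesis degp : deg_le p (c / 8 * M ^+ 2).
Hypothesis Fp : forall x, `|x| <= M -> `|F x - p.[x]| <= delta.
Hypothesis FB : forall x, `|x| <= M -> `|F x - F 0| <= B.
Hypothesis deltaB : delta <= B.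

Let n := Num.truncn (c / 8 * M ^+ 2).

Let K0 : 0 <= c / 8 * M ^+ 2.
Proof. by rewrite mulr_ge0 ?sqr_ge0// divr_ge0// ltW. Qed.

Let nK : n%:R <= c / 8 * M ^+ 2.
Proof. by rewrite truncn_le. Qed.

Let B0 : 0 <= B.
Proof. by apply: le_trans (normr_ge0 _) (FB (x := 0) _); rewrite normr0 ltW. Qed.

(** The sum skips the constant term, so [p] may be replaced by [p - F 0], which is at most
    [delta + B <= 2 B] on the interval. The degree bound [c M^2 / 8] turns the factors of
    [coef_sum_le] and [rescaled_sum_le] into the two exponentials. *)
Lemma coef_sum_expR_le (y : R) : 0 <= y ->
  \sum_(1 <= k < n.+1) `|p`_k| * y ^+ k <=
  2 * B * expR (3 / 8 * c * M ^+ 2) * expR (c * y ^+ 2 / 16).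
Proof.
move=> y0; pose q := p - (F 0)%:P.
have sp : (size p <= n.+1)%N.
  have : ((size p).-1 <= n)%N by rewrite truncn_ge_nat.
  by case: (size p).
have sq : (size q <= n.+1)%N.
  apply: leq_trans (size_polyD _ _) _.
  by rewrite size_polyN geq_max sp (leq_trans (size_polyC_leq1 _)).
have qB x : `|x| <= M -> `|q.[x]| <= 2 * B.
  move=> xM; rewrite hornerD hornerN hornerC.
  have -> : p.[x] - F 0 = (F x - F 0) - (F x - p.[x]) by ring.
  apply: le_trans (ler_normB _ _) _.
  by have := FB xM; have := Fp xM; have := deltaB; lra.
apply: (@le_trans _ _ (\sum_(i < n.+1) `|q`_i| * y ^+ i)).
  rewrite -(big_mkord predT (fun i => `|q`_i| * y ^+ i)) [leRHS]big_ltn//.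
  rewrite ler_wpDl ?mulr_ge0 ?exprn_ge0//.
  rewrite le_eqVlt; apply/orP; left; apply/eqP; apply: eq_big_nat => k /andP[k0 _].
  by rewrite /q coefB coefC gtn_eqF// subr0.
apply: le_trans (rescaled_sum_le n (fun i => q`_i) M0 y0) _.
apply: ler_pM; [| |apply: le_trans (coef_sum_le M0 sq qB) _|].
- by apply: sumr_ge0 => i _; rewrite mulr_ge0// exprn_ge0// ltW.
- exact: expR_ge0.
- rewrite ler_wpM2l ?mulr_ge0// ler_expR; move: nK; lra.
- rewrite ler_expR expr_div_n.
  have -> : c * y ^+ 2 / 16 = (c / 8 * M ^+ 2) * (y ^+ 2 / M ^+ 2 / 2).
    by field; rewrite gt_eqF.
  by rewrite ler_wpM2r// !divr_ge0// sqr_ge0.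
Qed.

Let f (u : R) := \sum_(1 <= k < n.+1) p`_k * hermite k u.

Lemma hermite_sum_sqr_ub (theta u : R) :
  f u ^+ 2 <= 4 * B ^+ 2 * expR (c * M ^+ 2 + c * theta ^+ 2 / 2) *
              expR ((u - theta) ^+ 2 / 4).
Proof.
(* The square of [b] is the degree bound, so [hpoly_ub] applies with [B = b] to every term of the
   sum. *)
pose b := Num.sqrt (c / 8 * M ^+ 2).
have b0 : 0 <= b by exact: sqrtr_ge0.
have b2 : b ^+ 2 = c / 8 * M ^+ 2 by rewrite sqr_sqrtr.
have ub0 : 0 <= `|u| + b by rewrite addr_ge0.
have h1 : `|f u| <= 2 * B * expR (3 / 8 * c * M ^+ 2) *
    expR (c * (`|u| + b) ^+ 2 / 16).
  apply: le_trans (coef_sum_expR_le ub0).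
  apply: le_trans (ler_norm_sum _ _ _) _.
  rewrite big_nat_cond [leRHS]big_nat_cond; apply: ler_sum => k /andP[/andP[_ kn] _].
  rewrite normrM hermiteE ler_wpM2l// hpoly_ub// b2.
  by apply: le_trans nK; rewrite ler_nat.
have -> : f u ^+ 2 = `|f u| ^+ 2 by rewrite real_normK ?num_real.
apply: le_trans (_ : (2 * B * expR (3 / 8 * c * M ^+ 2) *
    expR (c * (`|u| + b) ^+ 2 / 16)) ^+ 2 <= _).
  by rewrite ler_sqr ?nnegrE// !mulr_ge0// expR_ge0.
set E1 := expR (3 / 8 * _ * _); set E2 := expR (c * _ ^+ 2 / 16).
have -> : (2 * B * E1 * E2) ^+ 2 = 4 * B ^+ 2 * (E1 * E1 * (E2 * E2)) by ring.
rewrite -[leRHS]mulrA; apply: ler_wpM2l; first by rewrite mulr_ge0// sqr_ge0.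
rewrite -!expRD ler_expR.
have hu : (`|u| + b) ^+ 2 <= 2 * (u ^+ 2 + b ^+ 2).
  have -> : u ^+ 2 = `|u| ^+ 2 by rewrite real_normK ?num_real.
  have := sqr_ge0 (`|u| - b); nra.
have hth : u ^+ 2 <= 2 * (theta ^+ 2 + (u - theta) ^+ 2).
  have := sqr_ge0 (u - 2 * theta); nra.
have hM := sqr_ge0 M; have hz := sqr_ge0 (u - theta).
have {}hu : c * (`|u| + b) ^+ 2 <= c * (4 * (theta ^+ 2 + (u - theta) ^+ 2) + c / 4 * M ^+ 2).
  by rewrite ler_pM2l//; move: hu; rewrite b2; lra.
(* The exponent contains [c / 2] times this square; [c <= 1 / 2] keeps it within the [1 / 4] whose
   moment is known. *)
have cz : c * (u - theta) ^+ 2 <= 1 / 2 * (u - theta) ^+ 2 by rewrite ler_wpM2r.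
have cM : c * (c * M ^+ 2) <= 1 / 2 * (c * M ^+ 2).
  by rewrite ler_wpM2r// mulr_ge0// ltW.
have cM0 : 0 <= c * M ^+ 2 by rewrite mulr_ge0// ltW.
lra.
Qed.

Lemma measurable_hermite_sum : measurable_fun [set: R] f.
Proof.
have -> : f = horner (\sum_(1 <= k < n.+1) p`_k *: hpoly k).
  apply/funext => u; rewrite horner_sum; apply: eq_bigr => k _.
  by rewrite hornerZ hermiteE.
apply: continuous_measurable_fun; exact: continuous_horner.
Qed.

Variable theta : R.
Local Notation N := (normal_prob theta 1).

Lemma integrable_hermite_sum : N.-integrable setT (EFin \o f).
Proof.
have [] // := Rintegral_bigsum (P := N) (index_iota 1 n.+1)
  (F := fun k u => p`_k * hermite k u).
move=> k; apply: integrableZ_EFin.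
rewrite (_ : hermite k = fun u => (hpoly k).[u]); first exact: integrable_hpoly.
by apply/funext => u; rewrite hermiteE.
Qed.

Lemma horner_sub0 : p.[theta] - p.[0] = \sum_(1 <= k < n.+1) p`_k * theta ^+ k.
Proof.
have sp : (size p <= n.+1)%N.
  have : ((size p).-1 <= n)%N by rewrite truncn_ge_nat.
  by case: (size p).
rewrite (horner_coef_wide theta sp) horner_coef0.
rewrite -(big_mkord predT (fun i => p`_i * theta ^+ i)) big_ltn//.
by rewrite expr0 mulr1 addrC addKr.
Qed.

(** Meant for [theta] outside the interval, where the approximation error gives no information on
    [p]. *)
Lemma horner_sub0_le : `|p.[theta] - p.[0]| <=
  2 * B * expR (3 / 8 * c * M ^+ 2) * expR (c * theta ^+ 2 / 16).
Proof.
rewrite horner_sub0; apply: le_trans (ler_norm_sum _ _ _) _.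
rewrite -[theta ^+ 2](real_normK (num_real _)).
apply: le_trans (coef_sum_expR_le (normr_ge0 theta)).
by apply: ler_sum => k _; rewrite normrM normrX.
Qed.

Lemma integral_hermite_sum : \int[N]_u f u = p.[theta] - p.[0].
Proof.
have ih k : N.-integrable setT (EFin \o (hermite k : R -> R)).
  rewrite (_ : hermite k = fun u => (hpoly k).[u]); first exact: integrable_hpoly.
  by apply/funext => u; rewrite hermiteE.
have [_ ->] := Rintegral_bigsum (P := N) (index_iota 1 n.+1)
  (F := fun k u => p`_k * hermite k u) (fun k => integrableZ_EFin p`_k (ih k)).
rewrite horner_sub0; apply: eq_bigr => k _.
rewrite RintegralZl//; congr (_ * _); rewrite /Rintegral.
under eq_integral do rewrite hermiteE.
by rewrite integral_hpoly.
Qed.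

Lemma integrable_hermite_sum_sqr : N.-integrable setT (EFin \o (fun u => f u ^+ 2)).
Proof.
apply: (@le_integrable _ _ _ N _ measurableT _ (fun u =>
  (4 * B ^+ 2 * expR (c * M ^+ 2 + c * theta ^+ 2 / 2))%:E *
  (expR ((u - theta) ^+ 2 / 4))%:E)%E).
- apply/measurable_EFinP/measurable_funX; exact: measurable_hermite_sum.
- move=> u _ /=; rewrite lee_fin ger0_norm ?sqr_ge0//.
  by apply: le_trans (hermite_sum_sqr_ub theta u) (ler_norm _).
- by apply: integrableZl => //; exact: integrable_expR_sqr.
Qed.

Lemma integral_hermite_sum_sqr_le :
  \int[N]_u (f u ^+ 2) <= 8 * B ^+ 2 * expR (c * M ^+ 2 + c * theta ^+ 2 / 2).
Proof.
set C := 4 * B ^+ 2 * expR (c * M ^+ 2 + c * theta ^+ 2 / 2).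
have ie := integrable_expR_sqr theta.
apply: (@le_trans _ _ (\int[N]_u (C * expR ((u - theta) ^+ 2 / 4)))).
  apply: le_Rintegral => //; first exact: integrable_hermite_sum_sqr.
    exact: integrableZ_EFin.
  by move=> u _; exact: hermite_sum_sqr_ub.
have s2 := sqrtr2_le2 R.
rewrite RintegralZl// [X in _ * X]/Rintegral integral_expR_sqr/=.
rewrite (_ : 8 * B ^+ 2 * _ = C * 2); last by rewrite /C; ring.
by apply: ler_wpM2l => //; rewrite !mulr_ge0// ?sqr_ge0 ?expR_ge0.
Qed.

End level.

(** * Gaussian tail bounds *)

Section tail.
Context {R : realType}.
Variable theta : R.
Local Notation N := (normal_prob theta 1).

(** Markov's inequality for [exp ((v - theta)^2 / 4)], whose mean [sqrt 2] is rounded up to [2]. *)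
Lemma normal_prob_tail (a : R) (A : set R) : measurable A ->
  (forall v, A v -> a <= (v - theta) ^+ 2 / 4) -> fine (N A) <= 2 * expR (- a).
Proof.
move=> mA Aa; have ie := integrable_expR_sqr theta.
have s2 := sqrtr2_le2 R.
apply: (@le_trans _ _ (expR (- a) * Num.sqrt 2)); last first.
  by rewrite [leRHS]mulrC ler_wpM2l// expR_ge0.
have -> : fine (N A) = \int[N]_v (\1_A v).
  by rewrite /Rintegral integral_indic// setIT.
have -> : Num.sqrt 2 = \int[N]_v expR ((v - theta) ^+ 2 / 4).
  by rewrite /Rintegral integral_expR_sqr.
rewrite -RintegralZl//; apply: le_Rintegral => //.
- exact: integrable_indic.
- exact: integrableZ_EFin.
- move=> v _; rewrite indicE; have [/set_mem Av|_] := boolP (v \in A).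
    by rewrite -expRD -[leLHS]expR0 ler_expR; have := Aa v Av; lra.
  by rewrite mulr_ge0// expR_ge0.
Qed.

End tail.

(** * Comparison of exponents on one level *)

Section level_inequalities.
Context {R : realType}.
Variables (eps1 eps2 c C1 C2 M delta theta pr : R).
Hypotheses (e1 : 0 < eps1) (e2 : 0 < eps2) (e12 : eps1 + eps2 <= 1 / 1000).
Hypotheses (c0 : 0 < c) (c1 : c <= 1 / 1000) (C10 : 0 < C1) (C20 : 0 < C2).
Hypotheses (delta0 : 0 <= delta) (A2M : 1 <= C2 * delta * expR (eps2 * M ^+ 2)).
Hypothesis pr0 : 0 <= pr.

(** Multiplying by the right side of [A2M], which is at least [1], brings in [delta]. The growth
    rates [eps1 + c] and [eps2] are small against the decay [1 / 16], and the remaining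
    [exp (- M^2 / 128)] is kept for summing over levels. *)
Lemma far_bias_le (G : R) : M ^+ 2 <= theta ^+ 2 -> pr <= 2 * expR (- (theta ^+ 2 / 16)) ->
  0 <= G ->
  G <= 2 * (C1 * expR (eps1 * M ^+ 2)) * expR (3 / 8 * c * M ^+ 2) *
         expR (c * theta ^+ 2 / 16) + C1 * expR (eps1 * theta ^+ 2) ->
  pr * G <= 6 * C1 * C2 * delta * expR (- (M ^+ 2 / 128)).
Proof.
move=> Mt prt G0 HG; have M20 := sqr_ge0 M.
have A2X := A2M; set X := M ^+ 2 in Mt HG M20 A2X *; set Y := theta ^+ 2 in Mt prt HG *.
have b1 : eps1 * X <= eps1 * Y by rewrite ler_pM2l.
have b2 : eps2 * X <= eps2 * Y by rewrite ler_pM2l.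
have b3 : c * X <= c * Y by rewrite ler_pM2l.
have Y0 : 0 <= Y by exact: le_trans Mt.
have cY : c * Y <= 1 / 1000 * Y by rewrite ler_wpM2r.
have eY : (eps1 + eps2) * Y <= 1 / 1000 * Y by rewrite ler_wpM2r.
have cY0 : 0 <= c * Y by rewrite mulr_ge0// ltW.
have G1 : G <= 3 * C1 * expR ((eps1 + c) * Y).
  apply: le_trans HG _.
  have h1 : expR (eps1 * X) * (expR (3 / 8 * c * X) * expR (c * Y / 16)) <= expR ((eps1 + c) * Y).
    by rewrite -!expRD ler_expR; lra.
  have h2 : expR (eps1 * Y) <= expR ((eps1 + c) * Y).
    by rewrite ler_expR; lra.
  have {}h1 := ler_wpM2l (ltW C10) h1; have {}h2 := ler_wpM2l (ltW C10) h2.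
  move: h1 h2; move: (expR _) (expR _) (expR _) (expR _) (expR _) => a1 a2 a3 a4 a5; lra.
apply: (@le_trans _ _ (pr * G * (C2 * delta * expR (eps2 * X)))).
  by rewrite ler_peMr// mulr_ge0.
apply: (@le_trans _ _ (2 * expR (- (Y / 16)) * (3 * C1 * expR ((eps1 + c) * Y)) *
    (C2 * delta * expR (eps2 * X)))).
  apply: ler_wpM2r; first by apply: le_trans A2X.
  exact: ler_pM.
have h : expR (- (Y / 16)) * (expR ((eps1 + c) * Y) * expR (eps2 * X)) <= expR (- (X / 128)).
  rewrite -!expRD ler_expR; lra.
have D0 : 0 <= 6 * C1 * C2 * delta by rewrite !mulr_ge0// ltW.
have := ler_wpM2l D0 h.
by move: (expR _) (expR _) (expR _) (expR _) => a1 a2 a3 a4; lra.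
Qed.

Variable V : R.
Hypothesis V0 : 0 <= V.
Hypothesis HV : V <= 8 * (C1 * expR (eps1 * M ^+ 2)) ^+ 2 *
  expR (c * M ^+ 2 + c * theta ^+ 2 / 2).

(** Here [A2M] enters squared, to produce [delta^2]. *)
Lemma level_var_le : V <= 8 * C1 ^+ 2 * C2 ^+ 2 * delta ^+ 2 *
  expR (2 * (eps1 + eps2) * M ^+ 2 + c * M ^+ 2 + c * theta ^+ 2 / 2).
Proof.
apply: (@le_trans _ _ (V * (C2 * delta * expR (eps2 * M ^+ 2)) ^+ 2)).
  by rewrite ler_peMr// exprn_ege1.
apply: le_trans (ler_wpM2r (sqr_ge0 _) HV) _.
rewrite le_eqVlt; apply/orP; left; apply/eqP.
have -> : 2 * (eps1 + eps2) * M ^+ 2 + c * M ^+ 2 + c * theta ^+ 2 / 2 =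
  eps1 * M ^+ 2 + eps1 * M ^+ 2 + (eps2 * M ^+ 2 + eps2 * M ^+ 2) +
  (c * M ^+ 2 + c * theta ^+ 2 / 2) by ring.
by move: (c * M ^+ 2 + _) => b; rewrite !expRD; ring.
Qed.

Lemma near_var_le : theta ^+ 2 <= M ^+ 2 ->
  V <= 8 * C1 ^+ 2 * C2 ^+ 2 * delta ^+ 2 * expR (M ^+ 2 / 4).
Proof.
move=> tM; apply: le_trans level_var_le _; apply: ler_wpM2l.
  by rewrite !(mulr_ge0, exprn_ge0)// ltW.
have M20 := sqr_ge0 M.
have cY : c * M ^+ 2 <= 1 / 1000 * M ^+ 2 by rewrite ler_wpM2r.
have eY : (eps1 + eps2) * M ^+ 2 <= 1 / 1000 * M ^+ 2 by rewrite ler_wpM2r.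
have b3 : c * theta ^+ 2 <= c * M ^+ 2 by rewrite ler_pM2l.
by rewrite ler_expR; lra.
Qed.

(** The tail exponent [a] must exceed the growth of the second moment by [M^2 / 128], the surplus
    that makes the levels summable. *)
Lemma tail_var_le (a : R) : pr <= 2 * expR (- a) ->
  2 * (eps1 + eps2) * M ^+ 2 + c * M ^+ 2 + c * theta ^+ 2 / 2 + M ^+ 2 / 128 <= a ->
  pr * V <= 16 * C1 ^+ 2 * C2 ^+ 2 * delta ^+ 2 * expR (- (M ^+ 2 / 128)).
Proof.
move=> pra ha; apply: le_trans (ler_pM pr0 V0 pra level_var_le) _.
set b := 2 * _ * _ + _ + _.
have h : expR (- a) * expR b <= expR (- (M ^+ 2 / 128)).
  by rewrite -expRD ler_expR /b; lra.
have D0 : 0 <= 16 * C1 ^+ 2 * C2 ^+ 2 * delta ^+ 2 by rewrite !(mulr_ge0, exprn_ge0)// ltW.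
by have := ler_wpM2l D0 h; set a1 := expR _; set a2 := expR _; set a3 := expR _; lra.
Qed.

End level_inequalities.

(** * The levels and the best approximations *)

Section level_facts.
Context {R : realType}.
Variables (s d : nat) (L : int).

Local Notation Mmin := (@Mmin R s d).
Local Notation Mmax := (@Mmax R d).
Local Notation r := (s%:R ^+ 2 / d%:R : R).
Local Notation M l := (@Mlev R s d L l%:Z).
(** The index is shifted: [T l] is the lower threshold [t_{l-1}] of level [l], and [T l.+1] is the
    upper one. *)
Local Notation T l := (@tlev R s d L (l%:Z - 1)).

Lemma tlev0 : T 0%N = 0.
Proof. by []. Qed.

Lemma tlevS l : (l < nlev L)%N -> T l.+1 = M l / 2.
Proof.
move=> lL; rewrite /tlev (_ : l.+1%:Z - 1 = l%:Z); last by lia.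
by [].
Qed.

Hypotheses (d0 : (0 < d)%N) (sd4 : 2 * Num.sqrt d%:R <= s%:R :> R) (sd : (s <= d)%N).
Hypothesis HL : largest_level (R := R) s d L.

Let dR0 : (0 : R) < d%:R. Proof. by rewrite ltr0n. Qed.

Lemma sqrt_dim_le : Num.sqrt d%:R <= s%:R :> R.
Proof. by apply: le_trans sd4; have := sqrtr_ge0 (d%:R : R); lra. Qed.

Lemma ratio_ge4 : 4 <= r.
Proof.
rewrite ler_pdivlMr//; have := sqr_sqrtr (ltW dR0) => <-.
rewrite (_ : 4 * _ = (2 * Num.sqrt d%:R) ^+ 2); last by ring.
by rewrite ler_sqr ?nnegrE ?mulr_ge0 ?sqrtr_ge0.
Qed.

Lemma ratio_le_dim : r <= d%:R.
Proof.
rewrite ler_pdivrMr// -expr2 ler_sqr ?nnegrE//.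
by rewrite ler_nat.
Qed.

Lemma ln_ratio_ge1 : 1 <= ln r.
Proof.
have r4 := ratio_ge4.
rewrite -[leLHS]expRK ler_ln ?posrE ?expR_gt0 ?(lt_le_trans _ r4)//.
apply: le_trans r4.
(* The target is now [e <= 4]; it follows from [exp (1/2) <= 2], that is, from
   [1 - 1/2 <= exp (- 1/2)]. *)
have h := expR_ge1Dx (- (1 / 2) : R).
have e := expR_gt0 (1 / 2 : R).
have m : expR (1 / 2) * expR (- (1 / 2)) = 1 :> R by rewrite expRxMexpNx_1.
have h2 : expR (1 / 2) <= 2 :> R.
  have := ler_wpM2l (ltW e) h; rewrite m; lra.
rewrite (_ : (1 : R) = 1 / 2 + 1 / 2) ?expRD; last by lra.
by have := ler_pM (ltW e) (ltW e) h2 h2; lra.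
Qed.

Let r0 : 0 < r. Proof. by apply: lt_le_trans ratio_ge4. Qed.

Let lnr0 : 0 < ln r. Proof. by apply: lt_le_trans ln_ratio_ge1. Qed.

Lemma ln_ratio_le : ln r <= ln (d%:R : R).
Proof. by rewrite ler_ln ?posrE// ratio_le_dim. Qed.

Let lnd0 : 0 < ln (d%:R : R). Proof. exact: lt_le_trans ln_ratio_le. Qed.

Lemma Mmin_sqr : Mmin ^+ 2 = 2 * ln r.
Proof. by rewrite sqr_sqrtr// mulr_ge0// ltW. Qed.

Lemma Mmax_sqr : Mmax ^+ 2 = 2 * ln (d%:R : R).
Proof. by rewrite sqr_sqrtr// mulr_ge0// ltW. Qed.

Lemma Mmin_gt0 : 0 < Mmin. Proof. by rewrite sqrtr_gt0 mulr_gt0. Qed.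

Lemma Mmin_le_Mmax : Mmin <= Mmax.
Proof. by rewrite ler_wsqrtr// ler_pM2l// ln_ratio_le. Qed.

Lemma expR_Mmin : expR (Mmin ^+ 2 / 2) = r.
Proof. by rewrite Mmin_sqr mulrC mulKf// lnK. Qed.

(** The left side equals [sqrt d]. The factor [s] thereby pays for the growth of the second moment
    at a nonzero coordinate. *)
Lemma expR_Mmax : expR (Mmax ^+ 2 / 4) <= s%:R.
Proof.
apply: le_trans sqrt_dim_le.
rewrite -(ger0_norm (expR_ge0 _)) -sqrtr_sqr ler_wsqrtr//.
by rewrite -expRM_natl Mmax_sqr (_ : _ * _ = ln d%:R) ?lnK//; by field.
Qed.

Let admissibleE (k : int) :
  ((2 : R) ^ k < Num.sqrt (ln d%:R / ln r)) = (2 ^ k * Mmin < Mmax).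
Proof.
have -> : Mmax = Num.sqrt (ln d%:R / ln r) * Mmin.
  rewrite -sqrtrM; last by rewrite divr_ge0// ltW.
  by congr Num.sqrt; field; rewrite gt_eqF.
by rewrite ltr_pM2r// Mmin_gt0.
Qed.

(** The index [-1] is always admissible, as [Mmin / 2 < Mmin <= Mmax]. Hence [absz] in [nlev] does
    not change a sign. *)
Lemma largest_level_ge : - 1 <= L.
Proof.
apply: HL.2; rewrite admissibleE; apply: lt_le_trans Mmin_le_Mmax.
rewrite gtr_pMl ?Mmin_gt0// exprN1; lra.
Qed.

Lemma nlevE : (nlev L)%:Z = L + 1.
Proof. by have := largest_level_ge; rewrite /nlev; lia. Qed.

Lemma Mlev_lt l : (l < nlev L)%N -> M l = 2 ^+ l * Mmin /\ M l < Mmax.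
Proof.
move=> lL; have lL' : l%:Z <= L by have := nlevE; lia.
rewrite /Mlev lL' -exprnP; split=> //.
have [+ _] := HL; rewrite admissibleE; apply: le_lt_trans.
by rewrite ler_pM2r ?Mmin_gt0// exprnP ler_weXz2l// ler1n.
Qed.

Lemma Mlev_last : M (nlev L) = Mmax.
Proof. by rewrite /Mlev nlevE ifN// -ltNge ltrDl. Qed.

Lemma Mmax_le : Mmax <= 2 ^+ nlev L * Mmin.
Proof.
rewrite leNgt; apply/negP; rewrite exprnP nlevE -admissibleE => /(HL.2).
by rewrite gerDl.
Qed.

Lemma Mlev_bounds l : (l <= nlev L)%N -> Mmin <= M l <= Mmax.
Proof.
rewrite leq_eqVlt => /predU1P[->|/Mlev_lt[E /ltW ->]].
  by rewrite Mlev_last lexx Mmin_le_Mmax.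
by rewrite andbT E ler_peMl ?(ltW Mmin_gt0)// exprn_ege1// ler1n.
Qed.

Lemma Mlev0 : M 0%N = Mmin.
Proof.
(* Without any dyadic level, level [0] is the last one and maximality of [L] forces
   [Mmax = Mmin]. *)
have [n0|n0] := posnP (nlev L).
  have := Mlev_last; rewrite n0 => ->; apply/le_anti; rewrite Mmin_le_Mmax andbT.
  by have := Mmax_le; rewrite n0 expr0 mul1r.
by have [-> _] := Mlev_lt n0; rewrite expr0 mul1r.
Qed.

(** Geometric growth weakened to linear growth, enough for a geometric series in [l]. The last level
    is only compared with its predecessor, hence the shift by one in [key]. *)
Lemma Mlev_sqr_ge l : (l <= nlev L)%N -> 2 * l%:R <= M l ^+ 2.
Proof.
have M2 : 2 <= Mmin ^+ 2 by rewrite Mmin_sqr ler_peMr// ln_ratio_ge1.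
have pow k : (k.+1%:R : R) <= (2 ^+ k) ^+ 2.
  apply: (@le_trans _ _ (2 ^+ k)); first by rewrite -natrX ler_nat ltn_expl.
  by rewrite expr2 ler_peMr ?exprn_ge0// exprn_ege1// ler1n.
have key k (y : R) : 2 ^+ k * Mmin <= y -> 2 * k.+1%:R <= y ^+ 2.
  move=> h; have p0 : 0 <= 2 ^+ k * Mmin by rewrite mulr_ge0 ?exprn_ge0 ?(ltW Mmin_gt0).
  apply: le_trans (_ : (2 ^+ k * Mmin) ^+ 2 <= _); last first.
    by rewrite ler_sqr ?nnegrE// (le_trans p0).
  by rewrite exprMn mulrC; apply: ler_pM.
rewrite leq_eqVlt => /predU1P[->|ln].
  rewrite Mlev_last; case E : (nlev L) => [|n]; first by rewrite mulr0 sqr_ge0.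
  apply: key; have [|<- /ltW//] := @Mlev_lt n; by rewrite E.
have [E _] := Mlev_lt ln; apply: le_trans (key l _ _); last by rewrite E.
by rewrite ler_pM2l// ler_nat.
Qed.

(** Consecutive levels grow by a factor of at most [2], the last one included by [Mmax_le]. At
    [theta = 0], selecting level [l.+1] thus forces a deviation of order [M l.+1]. *)
Lemma tlev_ge l : (l < nlev L)%N -> M l.+1 / 4 <= T l.+1.
Proof.
move=> lL; rewrite tlevS//; have [E _] := Mlev_lt lL; rewrite E.
suff : M l.+1 <= 2 ^+ l.+1 * Mmin by rewrite exprS; lra.
have [->|lN] := eqVneq l.+1 (nlev L); first by rewrite Mlev_last; exact: Mmax_le.
have lS : (l.+1 < nlev L)%N by rewrite ltn_neqAle lN.
by have [-> _] := Mlev_lt lS.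
Qed.

Lemma tlev_le l : (l < nlev L)%N -> T l <= T l.+1.
Proof.
move=> lL; have MM := Mmin_gt0; rewrite tlevS//; have [E _] := Mlev_lt lL; rewrite E.
case: l lL E => [|l] lL E.
  by rewrite tlev0 divr_ge0// mulr_ge0 ?exprn_ge0// ltW.
rewrite tlevS; last exact: ltnW; have [-> _] := Mlev_lt (ltnW lL).
have : 0 <= 2 ^+ l * Mmin by rewrite mulr_ge0 ?exprn_ge0// ltW.
by rewrite exprS; lra.
Qed.

End level_facts.

(** * Partition of the line by the thresholds *)

Section shells.
Context {R : realType}.
Variables (N : nat) (t : nat -> R).
Hypothesis t_le : forall l, (l < N)%N -> t l <= t l.+1.

(** The upper threshold is conditional because the last shell is unbounded. *)
Definition shell (l : nat) : set R :=
  [set v | t l < `|v| /\ ((l < N)%N -> `|v| <= t l.+1)].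

Lemma measurable_shell l : measurable (shell l).
Proof.
have mnorm (A : set R) : measurable A -> measurable ((@Num.norm R R) @^-1` A).
  by move=> mA; rewrite -[X in measurable X]setTI; exact: normr_measurable.
have m1 := mnorm _ (measurable_itv `]t l, +oo[).
have m2 := mnorm _ (measurable_itv `]-oo, t l.+1]).
rewrite (_ : shell l = ((@Num.norm R R) @^-1` `]t l, +oo[%classic) `&`
   (if (l < N)%N then (@Num.norm R R) @^-1` `]-oo, t l.+1]%classic else setT)).
  by case: ifP => _; [exact: measurableI|rewrite setIT].
apply/seteqP; split => v; rewrite /shell/= in_itv/= andbT.
  by move=> [-> h]; split=> //; case: ifP => // lN; rewrite /= in_itv/= h.
by move=> [-> h]; split=> // lN; move: h; rewrite lN /= in_itv/=.
Qed.

Lemma indic_shell l (v : R) : \1_(shell l) v =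
  (if (l < N)%N then t l < `|v| <= t l.+1 else t l < `|v|)%R%:R :> R.
Proof.
rewrite indicE; congr (nat_of_bool _)%:R; apply/idP/idP.
  move=> /set_mem[-> h]; case: ifP => // lN; exact: h.
move=> h; apply/mem_set; move: h; rewrite /shell /=.
by case: ifP => lN => [/andP[-> ->]|->].
Qed.

(* Telescoping, by monotonicity of [t]. *)
Lemma sum_indic_shell (v : R) : \sum_(l < N.+1) \1_(shell l) v = (t 0%N < `|v|)%R%:R :> R.
Proof.
rewrite big_ord_recr/= indic_shell ltnn.
rewrite (eq_bigr (fun l : 'I_N => (t l < `|v| <= t l.+1)%R%:R)); last first.
  by move=> l _; rewrite indic_shell ltn_ord.
suff : forall k, (k <= N)%N -> \sum_(l < k) (t l < `|v| <= t l.+1)%R%:R +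
    (t k < `|v|)%R%:R = (t 0%N < `|v|)%R%:R :> R by apply.
elim=> [|k IH] kN; first by rewrite big_ord0 add0r.
rewrite big_ord_recr/= -(IH (ltnW kN)) -addrA; congr (_ + _).
have := t_le kN; case: (ltP (t k.+1) `|v|) => h1 h2 /=.
  by rewrite andbF add0r (le_lt_trans h2 h1).
by rewrite andbT addr0.
Qed.

(* Expand [0 <= \sum_l (a l - x) ^ 2 1_l] with [x = \sum_l a l 1_l] and use
   [\sum_l 1_l <= 1]. *)
Lemma sqr_sum_shell_le (a : nat -> R) (v : R) :
  (\sum_(l < N.+1) a l * \1_(shell l) v) ^+ 2 <=
  \sum_(l < N.+1) a l ^+ 2 * \1_(shell l) v.
Proof.
set x := \sum_(l < N.+1) a l * _.
have h1 : \sum_(l < N.+1) \1_(shell l) v <= 1 :> R.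
  by rewrite sum_indic_shell; case: (_ < _).
have h2 : 0 <= \sum_(l < N.+1) (a l - x) ^+ 2 * \1_(shell l) v.
  by apply: sumr_ge0 => l _; rewrite mulr_ge0// sqr_ge0.
have h3 y : \sum_(l < N.+1) (a l - y) ^+ 2 * \1_(shell l) v =
    \sum_(l < N.+1) a l ^+ 2 * \1_(shell l) v - 2 * y * x +
    y ^+ 2 * \sum_(l < N.+1) \1_(shell l) v.
  by rewrite /x !mulr_sumr -sumrB -big_split/=; apply: eq_bigr => l _; ring.
move: h2; rewrite h3 => h2.
have := ler_wpM2l (sqr_ge0 x) h1; nra.
Qed.

(** With [t 0 = 0] and strict lower thresholds, the shells miss only the origin, a null set. *)
Lemma sum_normal_shell (theta : R) : t 0%N = 0 ->
  \sum_(l < N.+1) fine (normal_prob theta 1 (shell l)) = 1.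
Proof.
move=> t0; set P := normal_prob theta 1.
have ie l : P.-integrable setT (EFin \o (\1_(shell l) : R -> R)).
  by apply: integrable_indic => //; exact: measurable_shell.
have [_] := Rintegral_bigsum (P := P) (index_enum 'I_N.+1) (fun l : 'I_N.+1 => ie l).
under eq_Rintegral do rewrite sum_indic_shell t0.
rewrite (eq_bigr (fun l : 'I_N.+1 => fine (P (shell l)))); last first.
  move=> l _; rewrite /Rintegral integral_indic ?setIT//; exact: measurable_shell.
move=> <-.
have -> : (fun v : R => ((0 < `|v|)%R%:R : R)) = \1_(~` [set 0 : R]).
  apply/funext => v; rewrite indicE normr_gt0; congr (nat_of_bool _)%:R.
  apply/idP/idP; first by move=> /eqP v0; apply/mem_set.
  by move=> /set_mem /= /eqP.
have m0 : measurable ([set 0] : set R) by exact: measurable_set1.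
have P0 : P [set 0] = 0%E.
  have /null_content_dominatesP := normal_prob_dominates theta 1.
  by move=> /(_ [set 0] m0 (lebesgue_measure_set1 0)).
rewrite /Rintegral integral_indic ?setIT//; last exact: measurableC.
have PC := probability_setC P m0.
rewrite [X in fine X](_ : _ = 1%E)//.
by apply: etrans PC _; rewrite [X in (_ - X)%E]P0 sube0.
Qed.

End shells.

Section estimator_shells.
Context {R : realType}.
Variables (s d : nat) (L : int) (c : R) (P : R -> R -> {poly R}).
Hypothesis L1 : - 1 <= L.

Lemma Fhat_shells (u v : R) : Fhat s d L c P u v =
  \sum_(l < (nlev L).+1) Phat P (Klev s d L c l%:Z) (Mlev s d L l%:Z) u *
     \1_(shell (nlev L) (fun l => tlev s d L (l%:Z - 1)) l) v.
Proof.
have NL : (nlev L)%:Z = L + 1 by rewrite /nlev; lia.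
rewrite big_ord_recr/= indic_shell ltnn /Fhat NL addrK; congr (_ + _).
rewrite big_mkord; apply: eq_bigr => l _; rewrite indic_shell ltn_ord.
by rewrite (_ : l.+1%:Z - 1 = l%:Z)//; lia.
Qed.

End estimator_shells.

(** * Approximation errors and the growth conditions as real inequalities *)

Section best_approximation.
Context {R : realType}.
Implicit Types (g F : R -> R).

Lemma sup_norm_leP g (M B : R) :
  (sup_norm g M <= B%:E)%E <-> (forall x, `|x| <= M -> `|g x| <= B).
Proof.
split=> [H x xM|H].
  rewrite -lee_fin; apply: le_trans H; apply: ereal_sup_ubound.
  by exists x.
by apply: ge_ereal_sup => _ [x xM <-]; rewrite lee_fin H.
Qed.

Lemma sup_norm_ge0 g (M : R) : 0 <= M -> (0 <= sup_norm g M)%E.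
Proof.
move=> M0; apply: (@le_trans _ _ (`|g 0|)%:E); first by rewrite lee_fin.
by apply: ereal_sup_ubound; exists 0 => //=; rewrite normr0.
Qed.

Variables (F : R -> R) (P : R -> R -> {poly R}).
Hypothesis PF : best_approx_family F P.

(** The constant [F 0] has degree [0] and competes with the best approximation. With (A1) this makes
    every error finite. *)
Lemma delta_le_cst (K M B : R) : 0 <= K -> 0 <= M ->
  (sup_norm (fun x => F x - F 0)%R M <= B%:E)%E -> (delta F P K M <= B%:E)%E.
Proof.
move=> K0 M0; apply: le_trans; have [_ /(_ (F 0)%:P) H] := PF K0 M0.
have e : (fun x => F x - (F 0)%:P.[x]) = (fun x => F x - F 0).
  by apply/funext => x; rewrite hornerC.
rewrite e in H; apply: H; rewrite /deg_le.
by case: (size _) (size_polyC_leq1 (F 0)) => [|[|]].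
Qed.

Lemma delta_mono (K K' M : R) : 0 <= K -> K <= K' -> 0 <= M ->
  (delta F P K' M <= delta F P K M)%E.
Proof.
move=> K0 KK M0; have [_] := PF (le_trans K0 KK) M0; apply.
by have [+ _] := PF K0 M0; rewrite /deg_le => /le_trans; apply.
Qed.

Lemma delta_fineP (K M B : R) : 0 <= M -> (delta F P K M <= B%:E)%E ->
  [/\ delta F P K M = (fine (delta F P K M))%:E, 0 <= fine (delta F P K M) &
   forall x, `|x| <= M -> `|F x - (P K M).[x]| <= fine (delta F P K M)].
Proof.
move=> M0 dB; have d0 : (0 <= delta F P K M)%E by exact: sup_norm_ge0.
have E : delta F P K M = (fine (delta F P K M))%:E.
  rewrite fineK// ge0_fin_numE//; exact: le_lt_trans dB (ltry _).
split => //; first exact: fine_ge0.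
by apply/sup_norm_leP; rewrite -E.
Qed.

Variables (s d : nat).

Lemma A1_le (eps1 C1 M : R) : A1 s d F eps1 C1 -> Mmin s d <= M <= Mmax d ->
  (sup_norm (fun x => F x - F 0)%R M <= (C1 * expR (eps1 * M ^+ 2))%:E)%E.
Proof.
move=> HA MM; have h : (sup_norm (fun x => F x - F 0)%R M / (expR (eps1 * M ^+ 2))%:E <= C1%:E)%E.
  by apply: le_trans HA; apply: ereal_sup_ubound; exists M.
by move: h; rewrite inver gt_eqF ?expR_gt0// lee_pdivrMr ?expR_gt0// EFinM.
Qed.

(** The condition bounds the error at degree [M^2] from below; a smaller degree [K] only increases
    the error. *)
Lemma A2_le (eps2 C2 K M B : R) : A2 s d F P eps2 C2 -> Mmin s d <= M <= Mmax d ->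
  0 <= M -> 0 <= K -> K <= M ^+ 2 -> (delta F P K M <= B%:E)%E -> 0 < C2 ->
  1 <= C2 * fine (delta F P K M) * expR (eps2 * M ^+ 2).
Proof.
move=> HA MM M0 K0 KM dB C20.
have [E d0 _] := delta_fineP M0 dB.
have mono := delta_mono K0 KM M0.
have [E' d0' _] := delta_fineP M0 (le_trans mono dB).
move: mono; rewrite E E' lee_fin => mono.
have : ((delta F P (M ^+ 2) M)^-1 / (expR (eps2 * M ^+ 2))%:E <= C2%:E)%E.
  by apply: le_trans HA; apply: ereal_sup_ubound; exists M.
rewrite (inver (expR _)) gt_eqF ?expR_gt0// lee_pdivrMr ?expR_gt0//.
(* A zero error would have inverse [+oo], against the finite bound. *)
rewrite E' inver; case: eqVneq => [//|dn0].
rewrite -EFinM lee_fin => h.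
set x := fine _ in mono d0' dn0 h *; have x0 : 0 < x by rewrite lt0r dn0.
have := ler_wpM2r (ltW x0) h; rewrite mulVf// => h1.
apply: le_trans h1 _; rewrite mulrAC; apply: ler_wpM2r; first exact: expR_ge0.
by rewrite ler_pM2l.
Qed.

(** Provides one real number [D], the root of the maximum, that serves as error bound on all
    levels. *)
Lemma max_delta2P (L : int) (c : R) :
  (forall l, (l <= nlev L)%N -> delta F P (Klev s d L c l%:Z) (Mlev s d L l%:Z) \is a fin_num) ->
  exists D : R, [/\ 0 <= D, max_delta2 s d L c F P = (D ^+ 2)%:E &
    forall l, (l <= nlev L)%N ->
      fine (delta F P (Klev s d L c l%:Z) (Mlev s d L l%:Z)) <= D].
Proof.
move=> fin; set G := fun l => fine (delta F P (Klev s d L c l%:Z) (Mlev s d L l%:Z)).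
have E : max_delta2 s d L c F P = (\big[Num.max/0]_(0 <= l < (nlev L).+1) (G l ^+ 2))%:E.
  rewrite /max_delta2 (big_morph EFin (op1 := maxe) (id1 := 0%E)) //;
    last by move=> x y; rewrite EFin_max.
  apply: eq_big_nat => l /andP[_ lN]; rewrite -[X in (X ^+ 2)%E]fineK; last exact: fin.
  by rewrite -EFin_expe.
set D2 := \big[_/_]_(_ <= _ < _) _ in E.
have D20 : 0 <= D2.
  rewrite /D2; elim/big_ind: _ => // [x y x0 y0|l _]; last exact: sqr_ge0.
  by rewrite le_max x0.
exists (Num.sqrt D2); split; rewrite ?sqrtr_ge0 ?sqr_sqrtr// => l lN.
apply: le_trans (ler_norm _) _; rewrite -sqrtr_sqr ler_wsqrtr//.
apply: (@Order.TotalTheory.le_bigmax_seq _ _ _ _ 0 l predT (fun l => G l ^+ 2)) => //.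
by rewrite mem_index_iota.
Qed.

End best_approximation.

(** * Risk of the estimator *)

Section coordinate.
Context {R : realType}.
Variables (eps1 eps2 c C1 C2 : R).
Hypotheses (e1 : 0 < eps1) (e2 : 0 < eps2) (e12 : eps1 + eps2 <= 1 / 1000).
Hypotheses (c0 : 0 < c) (c1 : c <= 1 / 1000) (C10 : 0 < C1) (C20 : 0 < C2).
Variables (s d : nat) (L : int).
Hypotheses (d0 : (0 < d)%N) (sd4 : 2 * Num.sqrt d%:R <= s%:R :> R) (sd : (s <= d)%N).
Hypothesis HL : largest_level (R := R) s d L.
Variables (F : R -> R) (P : R -> R -> {poly R}).
Hypothesis PF : best_approx_family F P.
Hypotheses (HA1 : A1 s d F eps1 C1) (HA2 : A2 s d F P eps2 C2).

Local Notation N := (nlev L).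
Local Notation M l := (@Mlev R s d L l%:Z).
Local Notation K l := (Klev s d L c l%:Z).
Local Notation f l := (Phat P (K l) (M l)).
Local Notation dl l := (fine (delta F P (K l) (M l))).
Local Notation J := (shell N (fun l => @tlev R s d L (l%:Z - 1))).
Local Notation e l := (expR (- (M l ^+ 2 / 128))).

Let M_bounds l : (l <= N)%N -> Mmin s d <= M l <= Mmax d.
Proof. exact: Mlev_bounds. Qed.

Let M_gt0 l : (l <= N)%N -> 0 < M l.
Proof.
by move=> /M_bounds /andP[h _]; apply: lt_le_trans h; exact: Mmin_gt0.
Qed.

Let K_ge0 l : 0 <= K l.
Proof. by rewrite /Klev mulr_ge0 ?sqr_ge0// divr_ge0// ltW. Qed.

Let K_le l : K l <= M l ^+ 2.
Proof.
rewrite /Klev; have M20 := sqr_ge0 (M l).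
have := ler_wpM2r M20 c1; lra.
Qed.

Let FB l : (l <= N)%N -> forall x, `|x| <= M l ->
  `|F x - F 0| <= C1 * expR (eps1 * M l ^+ 2).
Proof. by move=> lN; apply/sup_norm_leP; exact: (A1_le HA1 (M_bounds lN)). Qed.

Lemma delta_lev_le l : (l <= N)%N ->
  (delta F P (K l) (M l) <= (C1 * expR (eps1 * M l ^+ 2))%:E)%E.
Proof.
move=> lN; apply: delta_le_cst => //; first exact: ltW (M_gt0 lN).
exact: (A1_le HA1 (M_bounds lN)).
Qed.

Let dlB l : (l <= N)%N -> dl l <= C1 * expR (eps1 * M l ^+ 2).
Proof.
move=> lN; have := delta_lev_le lN.
by have [-> _ _] := delta_fineP (ltW (M_gt0 lN)) (delta_lev_le lN).
Qed.

Let dl_ge0 l : (l <= N)%N -> 0 <= dl l.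
Proof.
by move=> lN; have [] := delta_fineP (ltW (M_gt0 lN)) (delta_lev_le lN).
Qed.

Let Fp l : (l <= N)%N ->
  forall x, `|x| <= M l -> `|F x - (P (K l) (M l)).[x]| <= dl l.
Proof.
by move=> lN; have [] := delta_fineP (ltW (M_gt0 lN)) (delta_lev_le lN).
Qed.

Let degP l : (l <= N)%N -> deg_le (P (K l) (M l)) (c / 8 * M l ^+ 2).
Proof. by move=> lN; have [] := PF (K_ge0 l) (ltW (M_gt0 lN)). Qed.

Let A2M l : (l <= N)%N -> 1 <= C2 * dl l * expR (eps2 * M l ^+ 2).
Proof.
move=> lN; have M0 := ltW (M_gt0 lN).
exact: (A2_le PF HA2 (M_bounds lN) M0 (K_ge0 l) (K_le l) (delta_lev_le lN) C20).
Qed.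

Let c_half : c <= 1 / 2. Proof. by have := c1; lra. Qed.

Variable D : R.
Hypothesis dlD : forall l, (l <= N)%N -> dl l <= D.

Let D0 : 0 <= D. Proof. exact: le_trans (dl_ge0 (leq0n _)) (dlD (leq0n _)). Qed.

Variable theta : R.
Hypothesis thetaM : `|theta| <= Mmax d.
Local Notation G := (normal_prob theta 1).
Local Notation pr l := (fine (G (J l))).

Let pr_ge0 l : 0 <= pr l. Proof. exact: fine_ge0. Qed.

Let sqr_normr (x : R) : `|x| ^+ 2 = x ^+ 2. Proof. by rewrite real_normK ?num_real. Qed.

(** As [|theta|] is at most [Mmax], the value on the last level, a level exceeded by [|theta|] has
    an upper threshold. *)
Let far_lt l : (l <= N)%N -> M l < `|theta| -> (l < N)%N.
Proof.
move=> lN; rewrite ltn_neqAle lN andbT; apply: contraTneq => ->.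
by rewrite Mlev_last// -leNgt.
Qed.

Let far_sqr l : (l <= N)%N -> M l < `|theta| -> M l ^+ 2 <= theta ^+ 2.
Proof.
move=> lN lt; rewrite -(sqr_normr theta) ler_sqr ?nnegrE//; first exact: ltW.
exact: ltW (M_gt0 lN).
Qed.

Let near_sqr l : (l <= N)%N -> `|theta| <= M l -> theta ^+ 2 <= M l ^+ 2.
Proof.
move=> lN lt; rewrite -(sqr_normr theta) ler_sqr ?nnegrE//.
exact: ltW (M_gt0 lN).
Qed.

(** Selecting such a level means [|v| <= M l / 2 < |theta| / 2], so [v] deviates from [theta] by at
    least [|theta| / 2]. *)
Let far_prob l : (l <= N)%N -> M l < `|theta| -> pr l <= 2 * expR (- (theta ^+ 2 / 16)).
Proof.
move=> lN lt; have ltN := far_lt lN lt.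
apply: normal_prob_tail; first exact: measurable_shell.
move=> v [_ /(_ ltN)]; rewrite tlevS// => hv.
have h1 : `|theta| <= `|v - theta| + `|v|.
  by have := ler_normB v (v - theta); rewrite subKr; lra.
have h2 : `|theta| / 2 <= `|v - theta| by lra.
have h3 : (`|theta| / 2) ^+ 2 <= `|v - theta| ^+ 2.
  by rewrite ler_sqr ?nnegrE// divr_ge0.
by move: h3; rewrite expr_div_n !sqr_normr; lra.
Qed.

Lemma level_bias_le l : (l <= N)%N ->
  pr l * `|(P (K l) (M l)).[theta] - (P (K l) (M l)).[0] - (F theta - F 0)| <=
  D * (2 * pr l + 6 * C1 * C2 * e l).
Proof.
move=> lN; have [near|far] := leP `|theta| (M l).
  have h1 := Fp lN near.
  have h2 : `|F 0 - (P (K l) (M l)).[0]| <= dl l.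
    by apply: (Fp lN); rewrite normr0 ltW// M_gt0.
  set p := P _ _ in h1 h2 *.
  have -> : p.[theta] - p.[0] - (F theta - F 0) =
    (F 0 - p.[0]) - (F theta - p.[theta]) by ring.
  apply: (@le_trans _ _ (pr l * (2 * D))).
    apply: ler_wpM2l => //; apply: le_trans (ler_normB _ _) _.
    by have := dlD lN; lra.
  have Q0 : 0 <= 6 * C1 * C2 * e l by rewrite !mulr_ge0 ?expR_ge0// ltW.
  by have := mulr_ge0 D0 Q0; lra.
apply: (@le_trans _ _ (6 * C1 * C2 * dl l * e l)).
  apply: (far_bias_le e1 e2 e12 c0 c1 C10 C20 (dl_ge0 lN) (A2M lN) (pr_ge0 l)
    (far_sqr lN far) (far_prob lN far)) => //.
  apply: le_trans (ler_normB _ _) _; apply: lerD.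
    exact: (horner_sub0_le (M_gt0 lN) c0 (degP lN) (Fp lN) (FB lN) (dlB lN)).
  rewrite -(sqr_normr theta).
  (* Being far, [|theta|] lies in the range of (A1), which is applied at the radius [|theta|]
     itself. *)
  have tM : Mmin s d <= `|theta| <= Mmax d.
    by rewrite thetaM andbT (le_trans _ (ltW far))//; case/andP: (M_bounds lN).
  by have /sup_norm_leP := A1_le HA1 tM; apply.
have h := dlD lN; have p2 := pr_ge0 l.
apply: (@le_trans _ _ (D * (6 * C1 * C2 * e l))).
  rewrite mulrAC [leRHS]mulrC; apply: ler_wpM2l => //.
  by rewrite !mulr_ge0 ?expR_ge0// ltW.
by rewrite ler_wpM2l// lerDr mulr_ge0.
Qed.

(** The variance budget of a coordinate: [d] shares of [s^2 / d] for zeros and [s] shares of [s] for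
    nonzeros are both worth [s^2]. *)
Let weight : R := if theta == 0 then s%:R ^+ 2 / d%:R else s%:R.

(** The growth of the second moment is paid either by [weight] ([near]) or by the small probability
    of selecting the level ([tail]). *)
Lemma level_risk_le l : (l <= N)%N ->
  pr l * (\int[G]_u (f l u ^+ 2)) <=
  16 * C1 ^+ 2 * C2 ^+ 2 * D ^+ 2 * weight * (pr l + e l).
Proof.
move=> lN; set V := \int[G]_u _.
have V0 : 0 <= V by apply: Rintegral_ge0 => u _; exact: sqr_ge0.
have HV : V <= 8 * (C1 * expR (eps1 * M l ^+ 2)) ^+ 2 *
    expR (c * M l ^+ 2 + c * theta ^+ 2 / 2).
  exact: (integral_hermite_sum_sqr_le (M_gt0 lN) c0 c_half (degP lN) (Fp lN) (FB lN) (dlB lN)).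
have dD2 : dl l ^+ 2 <= D ^+ 2 by rewrite ler_sqr ?nnegrE ?dl_ge0 ?dlD.
pose Q := C1 ^+ 2 * C2 ^+ 2.
have Q0 : 0 <= Q by rewrite mulr_ge0// sqr_ge0.
have QD0 : 0 <= Q * D ^+ 2 by rewrite mulr_ge0// sqr_ge0.
have QdD : Q * dl l ^+ 2 <= Q * D ^+ 2 by rewrite ler_wpM2l.
have Qd0 : 0 <= Q * dl l ^+ 2 by rewrite mulr_ge0// sqr_ge0.
have el0 : 0 <= e l by exact: expR_ge0.
have prl0 := pr_ge0 l.
have r4 := ratio_ge4 d0 sd4.
have near : theta ^+ 2 <= M l ^+ 2 -> expR (M l ^+ 2 / 4) <= weight ->
    pr l * V <= 16 * C1 ^+ 2 * C2 ^+ 2 * D ^+ 2 * weight * (pr l + e l).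
  move=> tM wM; have w0 : 0 <= weight by apply: le_trans wM; exact: expR_ge0.
  have h := near_var_le e12 c0 c1 C10 C20 (dl_ge0 lN) (A2M lN) V0 HV tM.
  have {}h : V <= 8 * (Q * D ^+ 2) * weight.
    apply: le_trans h _.
    by have := ler_pM Qd0 (expR_ge0 _) QdD wM; rewrite /Q; lra.
  apply: le_trans (ler_wpM2l prl0 h) _.
  have := mulr_ge0 (mulr_ge0 QD0 w0) prl0; have := mulr_ge0 (mulr_ge0 QD0 w0) el0.
  rewrite /Q; lra.
have tail (a : R) : 1 <= weight -> pr l <= 2 * expR (- a) ->
    2 * (eps1 + eps2) * M l ^+ 2 + c * M l ^+ 2 + c * theta ^+ 2 / 2 + M l ^+ 2 / 128 <= a ->
    pr l * V <= 16 * C1 ^+ 2 * C2 ^+ 2 * D ^+ 2 * weight * (pr l + e l).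
  move=> w1 pra ha; have w0 : 0 <= weight by apply: le_trans w1.
  apply: le_trans (tail_var_le C10 C20 (dl_ge0 lN) (A2M lN) prl0 V0 HV pra ha) _.
  have := ler_wpM2r el0 QdD; have := mulr_ge0 (mulr_ge0 QD0 w0) prl0.
  have := ler_wpM2l (mulr_ge0 QD0 el0) w1.
  rewrite /Q; lra.
have M20 := sqr_ge0 (M l).
have cM : c * M l ^+ 2 <= 1 / 1000 * M l ^+ 2 by rewrite ler_wpM2r.
have eM : (eps1 + eps2) * M l ^+ 2 <= 1 / 1000 * M l ^+ 2 by rewrite ler_wpM2r.
have [t0|t0] := eqVneq theta 0.
  have wE : weight = s%:R ^+ 2 / d%:R by rewrite /weight t0 eqxx.
  case: (posnP l) => [l0|l0].
    apply: near; first by rewrite t0 expr0n.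
    rewrite wE -(expR_Mmin d0 sd4) l0 Mlev0// ler_expR.
    by have := sqr_ge0 (@Mmin R s d); lra.
  (* Selection at [theta = 0] requires [|v| >= M l / 4], and [(M l / 4)^2 / 4 = M l ^ 2 / 64]. *)
  apply: (tail (M l ^+ 2 / 64)); [by rewrite wE; lra| |by rewrite t0 expr0n/=; lra].
  apply: normal_prob_tail; first exact: measurable_shell.
  case: l l0 lN {V V0 HV dD2 QdD Qd0 el0 prl0 near tail M20 cM eM} => // l _ lN v [hv _].
  have ht := tlev_ge d0 sd4 sd HL lN.
  have h1 : M l.+1 / 4 <= `|v| by apply: le_trans ht (ltW hv).
  have h3 : (M l.+1 / 4) ^+ 2 <= `|v| ^+ 2.
    by rewrite ler_sqr ?nnegrE// divr_ge0// ltW// M_gt0.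
  by move: h3; rewrite expr_div_n !sqr_normr t0 subr0; lra.
have wE : weight = s%:R by rewrite /weight (negbTE t0).
have s1 : (1 : R) <= s%:R.
  rewrite ler1n lt0n; apply/eqP => s0; move: r4; rewrite s0 expr0n/= mul0r; lra.
have [nr|fr] := leP `|theta| (M l).
  apply: near; first exact: near_sqr.
  rewrite wE; apply: le_trans (expR_Mmax d0 sd4 sd).
  rewrite ler_expR ler_pM2r// ler_sqr ?nnegrE ?sqrtr_ge0 ?(ltW (M_gt0 lN))//.
  by case/andP: (M_bounds lN).
apply: (tail (theta ^+ 2 / 16)); [by rewrite wE|exact: far_prob|].
have := far_sqr lN fr => ft.
have cT : c * theta ^+ 2 <= 1 / 1000 * theta ^+ 2 by rewrite ler_wpM2r// sqr_ge0.
lra.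
Qed.

(** The geometric series of ratio [exp (- 1/64)], which arises from [M l ^ 2 >= 2 l] in
    [exp (- M l ^ 2 / 128)]. *)
Definition tail_sum : R := (1 - expR (- (1 / 64)))^-1.

Lemma sum_expR_lev_le : \sum_(l < N.+1) e l <= tail_sum.
Proof.
set x := expR (- (1 / 64)) : R.
have x1 : x < 1 by rewrite expR_lt1; lra.
have x0 : 0 <= x by exact: expR_ge0.
apply: (@le_trans _ _ (\sum_(l < N.+1) x ^+ l)).
  apply: ler_sum => l _; rewrite /x -expRM_natl ler_expR.
  have lN : (l <= N)%N by rewrite -ltnS.
  by have := Mlev_sqr_ge d0 sd4 sd HL lN; lra.
rewrite /tail_sum -/x -[leRHS]mul1r ler_pdivlMr ?subr_gt0//.
have := subrX1 x N.+1; have := exprn_ge0 N.+1 x0; lra.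
Qed.

Let sum_pr : \sum_(l < N.+1) pr l = 1.
Proof. by apply: sum_normal_shell => // l lN; exact: tlev_le. Qed.

Lemma coordinate_bias_le :
  `|\sum_(l < N.+1) (\int[G]_u f l u) * pr l - (F theta - F 0)| <=
  (if theta == 0 then 0 else 1) * (D * (2 + 6 * C1 * C2 * tail_sum)).
Proof.
have eE (l : 'I_N.+1) : \int[G]_u f l u =
    (P (K l) (M l)).[theta] - (P (K l) (M l)).[0].
  have lN : (l <= N)%N by rewrite -ltnS.
  exact: (integral_hermite_sum c0 (degP lN)).
case: ifP => [/eqP t0|_].
  rewrite mul0r big1 => [|l _]; last by rewrite eE t0 subrr mul0r.
  by rewrite t0 !subrr normr0.
(* The selection probabilities sum to [1], so the target can be distributed over the levels. *)
have -> : F theta - F 0 = \sum_(l < N.+1) (F theta - F 0) * pr l.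
  by rewrite -mulr_sumr sum_pr mulr1.
rewrite mul1r -sumrB.
apply: le_trans (ler_norm_sum _ _ _) _.
apply: (@le_trans _ _ (\sum_(l < N.+1) D * (2 * pr l + 6 * C1 * C2 * e l))).
  apply: ler_sum => l _; rewrite eE -mulrBl normrM mulrC ger0_norm//.
  by apply: level_bias_le; rewrite -ltnS.
rewrite -mulr_sumr; apply: ler_wpM2l => //.
rewrite big_split/= -!mulr_sumr sum_pr mulr1 lerD2l ler_wpM2l ?sum_expR_lev_le//.
by rewrite !mulr_ge0// ltW.
Qed.

Lemma coordinate_risk_le :
  \sum_(l < N.+1) (\int[G]_u (f l u ^+ 2)) * pr l <=
  16 * C1 ^+ 2 * C2 ^+ 2 * D ^+ 2 * weight * (1 + tail_sum).
Proof.
have w0 : 0 <= weight.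
  by rewrite /weight; case: ifP => _ //; apply: le_trans (ratio_ge4 d0 sd4).
apply: (@le_trans _ _ (\sum_(l < N.+1)
    16 * C1 ^+ 2 * C2 ^+ 2 * D ^+ 2 * weight * (pr l + e l))).
  apply: ler_sum => l _; rewrite mulrC; apply: level_risk_le.
  by rewrite -ltnS.
rewrite -mulr_sumr; apply: ler_wpM2l.
  by rewrite !(mulr_ge0, exprn_ge0)// ltW.
by rewrite big_split/= sum_pr lerD2l sum_expR_lev_le.
Qed.

End coordinate.

Section second_moment.
Context d (T : measurableType d) (R : realType) (P : probability T R).
Local Notation integ f := (P.-integrable [set: T] (EFin \o f)).

(** Domination by [U^2 + V^2]. *)
Lemma integrableM_sqr (U V : T -> R) : integ U -> integ V ->
  integ (fun w => U w ^+ 2) -> integ (fun w => V w ^+ 2) ->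
  integ (fun w => U w * V w).
Proof.
move=> iU iV iU2 iV2.
have mU : measurable_fun [set: T] U by exact/measurable_EFinP/(measurable_int _ iU).
have mV : measurable_fun [set: T] V by exact/measurable_EFinP/(measurable_int _ iV).
apply: (@le_integrable _ _ _ P _ measurableT _
  ((EFin \o (fun w => U w ^+ 2)%R) \+ (EFin \o (fun w => V w ^+ 2)%R))%E).
- by apply/measurable_EFinP; exact: measurable_funM.
- move=> w _ /=; rewrite lee_fin normrM.
  rewrite [leRHS]ger0_norm; last by rewrite addr_ge0 ?sqr_ge0.
  rewrite -(real_normK (num_real (U w))) -(real_normK (num_real (V w))).
  by have := sqr_ge0 (`|U w| - `|V w|); have := sqr_ge0 (`|U w| + `|V w|); lra.
- exact: integrableD.
Qed.

End second_moment.

(** * Summation over the coordinates *)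

Section risk.
Context {R : realType}.
Variables (eps1 eps2 c C1 C2 : R).
Hypotheses (e1 : 0 < eps1) (e2 : 0 < eps2) (e12 : eps1 + eps2 <= 1 / 1000).
Hypotheses (c0 : 0 < c) (c1 : c <= 1 / 1000) (C10 : 0 < C1) (C20 : 0 < C2).
Variables (s n : nat) (L : int).
Hypotheses (n0 : (0 < n)%N) (sn4 : 2 * Num.sqrt n%:R <= s%:R :> R) (sn : (s <= n)%N).
Hypothesis HL : largest_level (R := R) s n L.
Variables (F : R -> R) (P : R -> R -> {poly R}).
Hypothesis PF : best_approx_family F P.
Hypotheses (HA1 : A1 s n F eps1 C1) (HA2 : A2 s n F P eps2 C2).
Variable D : R.
Hypothesis dlD : forall l, (l <= nlev L)%N ->
  fine (delta F P (Klev s n L c l%:Z) (Mlev s n L l%:Z)) <= D.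
Context (disp : measure_display) (T : measurableType disp) (Pr : probability T R).
Variables (theta : 'rV[R]_n) (y1 y2 : 'I_n -> {mfun T >-> R}).
Hypothesis sample : gaussian_sample Pr theta y1 y2.
Hypothesis thetaS : Theta s (Mmax n) theta.

Local Notation N := (nlev L).
Local Notation M l := (@Mlev R s n L l%:Z).
Local Notation K l := (Klev s n L c l%:Z).
Local Notation f l := (Phat P (K l) (M l)).
Local Notation J := (shell N (fun l => @tlev R s n L (l%:Z - 1))).
Local Notation G i := (normal_prob (theta ord0 i) 1).
Local Notation pr i l := (fine (G i (J l))).
Local Notation "'E[ f ]" := (\int[Pr]_w f w) (at level 0, f at level 99).
Local Notation integ f := (Pr.-integrable [set: T] (EFin \o f)).

Let W i w := Fhat s n L c P (y1 i w) (y2 i w).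
Let g i l w := f l (y1 i w) * \1_(J l) (y2 i w).

Let WE i : W i = fun w => \sum_(l < N.+1) g i l w.
Proof.
apply/funext => w; rewrite /W Fhat_shells//; exact: (largest_level_ge n0 sn4 sn HL).
Qed.

Let M_gt0 l : (l <= N)%N -> 0 < M l.
Proof.
move=> /(Mlev_bounds n0 sn4 sn HL) /andP[h _].
by apply: lt_le_trans h; exact: Mmin_gt0.
Qed.

Let dB l (lN : (l <= N)%N) := delta_lev_le c0 n0 sn4 sn HL PF HA1 lN.

Let K_ge0 l : 0 <= K l.
Proof. by rewrite /Klev mulr_ge0 ?sqr_ge0// divr_ge0// ltW. Qed.

Let degP l : (l <= N)%N -> deg_le (P (K l) (M l)) (c / 8 * M l ^+ 2).
Proof. by move=> lN; have [] := PF (K_ge0 l) (ltW (M_gt0 lN)). Qed.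

Let f_integ i l : (G i).-integrable setT (EFin \o f l).
Proof. exact: integrable_hermite_sum. Qed.

Let f2_integ i l : (l <= N)%N -> (G i).-integrable setT (EFin \o (fun u => f l u ^+ 2)).
Proof.
move=> lN; have M0 := M_gt0 lN.
have ch : c <= 1 / 2 by have := c1; lra.
have := delta_fineP (ltW M0) (dB lN).
have FB := (sup_norm_leP _ _ _).1 (A1_le HA1 (Mlev_bounds n0 sn4 sn HL lN)).
move=> [E _ Fp]; have := dB lN; rewrite E lee_fin => dB'.
exact: (integrable_hermite_sum_sqr M0 c0 ch (degP lN) Fp FB dB').
Qed.

Let mJ l : measurable (J l). Proof. exact: measurable_shell. Qed.

Let sqr_g i l w : g i l w ^+ 2 = f l (y1 i w) ^+ 2 * \1_(J l) (y2 i w).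
Proof. by rewrite /g exprMn indicE; case: (_ \in _); rewrite /= ?expr1n ?expr0n. Qed.

Let g_integ i l : integ (g i l).
Proof. by have [] := sample_expectation1 sample (f_integ i l) (mJ l). Qed.

Let g2_integ i l : (l <= N)%N -> integ (fun w => g i l w ^+ 2).
Proof.
move=> lN; have [] := sample_expectation1 sample (f2_integ i lN) (mJ l).
by rewrite (_ : (fun w => g i l w ^+ 2) = fun w => f l (y1 i w) ^+ 2 * \1_(J l) (y2 i w))//;
   apply/funext => w; rewrite sqr_g.
Qed.

Let leN (l : 'I_N.+1) : (l <= N)%N. Proof. by rewrite -ltnS. Qed.

Let W_integ i : integ (W i).
Proof.
by rewrite WE; have [] := Rintegral_bigsum (P := Pr) (index_enum 'I_N.+1) (fun l => g_integ i l).
Qed.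

Let W_mean i : 'E[W i] = \sum_(l < N.+1) (\int[G i]_u f l u) * pr i l.
Proof.
rewrite WE; have [_ ->] := Rintegral_bigsum (P := Pr) (index_enum 'I_N.+1) (fun l => g_integ i l).
apply: eq_bigr => l _.
by have [_] := sample_expectation1 sample (f_integ i l) (mJ l).
Qed.

Let W2_le i w : W i w ^+ 2 <= \sum_(l < N.+1) g i l w ^+ 2.
Proof.
under eq_bigr do rewrite sqr_g; rewrite WE.
apply: (@sqr_sum_shell_le _ N (fun l => tlev s n L (l%:Z - 1)) _
  (fun l => f l (y1 i w)) (y2 i w)).
by move=> l lN; exact: (tlev_le n0 sn4 sn HL).
Qed.

Let sum_g2_integ i : integ (fun w => \sum_(l < N.+1) g i l w ^+ 2) /\
  'E[fun w => \sum_(l < N.+1) g i l w ^+ 2] =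
  \sum_(l < N.+1) (\int[G i]_u (f l u ^+ 2)) * pr i l.
Proof.
have [h1 h2] := Rintegral_bigsum (P := Pr) (index_enum 'I_N.+1)
  (F := fun l w => g i l w ^+ 2) (fun l => g2_integ i (leN l)).
split=> //; rewrite h2; apply: eq_bigr => l _.
have [_ <-] := sample_expectation1 sample (f2_integ i (leN l)) (mJ l).
by apply: eq_Rintegral => w _; rewrite sqr_g.
Qed.

Let W2_integ i : integ (fun w => W i w ^+ 2).
Proof.
have mW : measurable_fun [set: T] (W i).
  exact/measurable_EFinP/(measurable_int _ (W_integ i)).
apply: (@le_integrable _ _ _ Pr _ measurableT _ _ _ _ (sum_g2_integ i).1).
  by apply/measurable_EFinP; exact: measurable_funX.
move=> w _ /=; rewrite lee_fin ger0_norm ?sqr_ge0//.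
exact: le_trans (W2_le i w) (ler_norm _).
Qed.

Let W2_mean_le i : 'E[fun w => W i w ^+ 2] <=
  \sum_(l < N.+1) (\int[G i]_u (f l u ^+ 2)) * pr i l.
Proof.
have [h1 <-] := sum_g2_integ i; apply: le_Rintegral => // w _; exact: W2_le.
Qed.

Let W_uncorrelated i j : i != j ->
  'E[fun w => W i w * W j w] = 'E[W i] * 'E[W j].
Proof.
move=> ij; rewrite !W_mean big_distrlr/= pair_bigA/=.
rewrite (_ : (fun w => W i w * W j w) =
    fun w => \sum_(lm : 'I_N.+1 * 'I_N.+1) g i lm.1 w * g j lm.2 w); last first.
  by apply/funext => w; rewrite !WE big_distrlr/= pair_bigA.
have ig (lm : 'I_N.+1 * 'I_N.+1) : integ (fun w => g i lm.1 w * g j lm.2 w).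
  apply: integrableM_sqr; [exact: g_integ|exact: g_integ|exact: g2_integ|exact: g2_integ].
have [_ ->] := Rintegral_bigsum (P := Pr) (index_enum ('I_N.+1 * 'I_N.+1)%type) ig.
apply: eq_bigr => -[l m] _ /=.
exact: (sample_expectation2 sample ij (f_integ i l) (f_integ j m) (mJ l) (mJ m)).
Qed.

Let thetaM i : `|theta ord0 i| <= Mmax n.
Proof.
have [_] := thetaS; apply: le_trans.
rewrite [leRHS]/Num.norm/= mx_normrE.
exact: (le_bigmax _ (fun ij : 'I_1 * 'I_n => `|theta ij.1 ij.2|) (ord0, i)).
Qed.

Let sum_nonzero : \sum_(i < n) (if theta ord0 i == 0 then 0 else 1) <= s%:R :> R.
Proof.
have [h _] := thetaS; apply: le_trans (_ : #|[set i : 'I_n | theta ord0 i != 0]%SET|%:R <= _).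
  rewrite -sum1_card natr_sum [leRHS]big_mkcond/=; apply: ler_sum => i _.
  by rewrite inE; case: eqVneq.
by rewrite ler_nat.
Qed.

Let D0 : 0 <= D.
Proof.
apply: le_trans (dlD (leq0n _)).
by have [] := delta_fineP (ltW (M_gt0 (leq0n _))) (dB (leq0n _)).
Qed.

Let S : R := tail_sum.

Let S0 : 0 <= S.
Proof. by rewrite invr_ge0 subr_ge0 expR_le1; lra. Qed.

Lemma risk_bound :
  integ (fun w => (estimator s L c F P (y1 ^~ w) (y2 ^~ w) - Fsum F theta) ^+ 2) /\
  'E[fun w => (estimator s L c F P (y1 ^~ w) (y2 ^~ w) - Fsum F theta) ^+ 2] <=
  ((2 + 6 * C1 * C2 * S) ^+ 2 + 32 * C1 ^+ 2 * C2 ^+ 2 * (1 + S)) *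
  s%:R ^+ 2 * D ^+ 2.
Proof.
(* The deterministic term [n F(0)] of the estimator is moved into the target. *)
pose tau := \sum_(i < n) (F (theta ord0 i) - F 0).
have -> : (fun w => (estimator s L c F P (y1 ^~ w) (y2 ^~ w) - Fsum F theta) ^+ 2) =
    (fun w => (\sum_(i < n) W i w - tau) ^+ 2).
  apply/funext => w; congr (_ ^+ 2); rewrite /estimator /Fsum /tau sumrB.
  by rewrite sumr_const card_ord -[F 0 *+ n]mulr_natl /W; ring.
have WW i j : integ (fun w => W i w * W j w) by exact: integrableM_sqr.
have [h1 h2] := uncorrelated_risk_le tau W_integ WW W_uncorrelated.
split=> //; apply: le_trans h2 _.
set b := 2 + 6 * C1 * C2 * S; set k := 16 * C1 ^+ 2 * C2 ^+ 2.
have b0 : 0 <= b by rewrite addr_ge0// !mulr_ge0// ltW.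
have k0 : 0 <= k by rewrite !(mulr_ge0, exprn_ge0)// ltW.
have bias : (\sum_(i < n) 'E[W i] - tau) ^+ 2 <= (s%:R * (D * b)) ^+ 2.
  rewrite -(real_normK (num_real (_ - tau))) ler_sqr ?nnegrE ?mulr_ge0//.
  rewrite -sumrB; apply: le_trans (ler_norm_sum _ _ _) _.
  apply: (@le_trans _ _ (\sum_(i < n) (if theta ord0 i == 0 then 0 else 1) * (D * b))).
    apply: ler_sum => i _; rewrite W_mean.
    exact: (coordinate_bias_le e1 e2 e12 c0 c1 C10 C20 n0 sn4 sn HL PF HA1 HA2 dlD (thetaM i)).
  by rewrite -mulr_suml ler_wpM2r// mulr_ge0.
have n0R : (0 : R) < n%:R by rewrite ltr0n.
have kD0 : 0 <= k * D ^+ 2 by rewrite mulr_ge0// sqr_ge0.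
have var : \sum_(i < n) 'E[fun w => W i w ^+ 2] <=
    k * D ^+ 2 * (2 * s%:R ^+ 2) * (1 + S).
  (* Every coordinate is granted [s^2 / n], and the at most [s] nonzero ones an additional [s]; the
     total is at most [2 s^2]. *)
  apply: (@le_trans _ _ (\sum_(i < n) k * D ^+ 2 *
      (s%:R ^+ 2 / n%:R + (if theta ord0 i == 0 then 0 else 1) * s%:R) * (1 + S))).
    apply: ler_sum => i _; apply: le_trans (W2_mean_le i) _.
    apply: le_trans (coordinate_risk_le e12 c0 c1 C10 C20 n0 sn4 sn HL PF HA1 HA2 dlD (thetaM i)) _.
    apply: ler_wpM2r; first by rewrite addr_ge0.
    apply: ler_wpM2l => //; case: ifP => _; first by rewrite mul0r addr0.
    by rewrite mul1r lerDr divr_ge0// ?sqr_ge0// ltW.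
  rewrite -mulr_suml -mulr_sumr; apply: ler_wpM2r; first by rewrite addr_ge0.
  apply: ler_wpM2l => //; rewrite big_split/= -(mulr_suml _ _ _ s%:R).
  rewrite sumr_const card_ord -(mulr_natr (_ / _)) divfK ?gt_eqF//.
  by have := ler_wpM2r (ler0n R s) sum_nonzero; rewrite -expr2; lra.
by have := lerD bias var; rewrite /k; lra.
Qed.

End risk.

Theorem theorem1 (R : realType) :
  exists (eps0 : R) (c0 : R -> R -> R) (C3 : R -> R -> R),
    [/\ 0 < eps0,
        forall eps1 eps2 : R, 0 < eps1 -> 0 < eps2 -> eps1 + eps2 <= eps0 ->
          0 < c0 eps1 eps2,
        forall C1 C2 : R, 0 < C1 -> 0 < C2 -> 0 < C3 C1 C2
      & forall eps1 eps2 C1 C2 : R,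
          0 < eps1 -> 0 < eps2 -> 0 < C1 -> 0 < C2 -> eps1 + eps2 <= eps0 ->
        forall c : R, 0 < c <= c0 eps1 eps2 ->
        forall s d : nat, (0 < d)%N ->
          2 * Num.sqrt d%:R <= s%:R :> R -> (s <= d)%N ->
        forall (F : R -> R) (P : R -> R -> {poly R}),
          best_approx_family F P ->
          A1 s d F eps1 C1 -> A2 s d F P eps2 C2 ->
        forall L : int, largest_level (R := R) s d L ->
        forall (disp : measure_display) (T : measurableType disp)
          (Pr : 'rV[R]_d -> probability T R)
          (y1 y2 : 'I_d -> {mfun T >-> R}),
          (forall theta, gaussian_sample (Pr theta) theta y1 y2) ->
        (ereal_sup
           [set 'E_(Pr theta)[fun w : T =>
                  ((estimator s L c F P (y1 ^~ w) (y2 ^~ w) -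
                    Fsum F theta) ^+ 2)%R]
           | theta in Theta (d := d) s (Mmax d)]
         <= (C3 C1 C2)%:E * (s%:R ^+ 2)%:E * max_delta2 s d L c F P)%E].
Proof.
(* The value [1 / 1000] leaves room in all comparisons of exponents. The third witness adds the
   constants of the squared bias and of the variance; [tail_sum] is a pure number. *)
exists (1 / 1000), (fun _ _ => 1 / 1000),
  (fun C1 C2 => (2 + 6 * C1 * C2 * tail_sum) ^+ 2 +
                32 * C1 ^+ 2 * C2 ^+ 2 * (1 + tail_sum)).
have S0 : 0 <= tail_sum :> R by rewrite invr_ge0 subr_ge0 expR_le1; lra.
split; [lra|by move=> *; lra| |].
  move=> C1 C2 C10 C20; apply: ltr_pwDl.
    by rewrite exprn_gt0// ltr_wpDr// !mulr_ge0// ltW.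
  by rewrite !(mulr_ge0, exprn_ge0, addr_ge0)// ltW.
move=> eps1 eps2 C1 C2 e1 e2 C10 C20 e12 c /andP[c0 c1] s n n0 sn4 sn F P PF HA1 HA2
  L HL disp T Pr y1 y2 sample.
have fin l : (l <= nlev L)%N ->
    delta F P (Klev s n L c l%:Z) (Mlev s n L l%:Z) \is a fin_num.
  move=> lN; have /andP[h _] := Mlev_bounds n0 sn4 sn HL lN.
  have M0 := le_trans (ltW (Mmin_gt0 n0 sn4)) h.
  by have [-> _ _] := delta_fineP M0 (delta_lev_le c0 n0 sn4 sn HL PF HA1 lN).
have [D [D0 -> dlD]] := max_delta2P fin.
apply: ge_ereal_sup => _ [theta thetaS <-].
have [ri rb] := risk_bound e1 e2 e12 c0 c1 C10 C20 n0 sn4 sn HL PF HA1 HA2 dlD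
  (sample theta) thetaS.
(* Integrability of the squared error identifies its extended expectation with the real one bounded
   in [rb]. *)
rewrite unlock -[X in (X <= _)%E]fineK; last exact: integrable_fin_num.
by rewrite -!EFinM lee_fin.
Qed.
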